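(* A 4-connected planar simple graph is $Oct_{1}^{+}$-free if and only if it is isomorphic to $C_{6}^{2}$.
   Context: $H$ is a minor of $G$ if $H$ can be obtained from $G$ by deleting vertices/edges and contracting edges; $G$ is $H$-free if it has no minor isomorphic to $H$. $Oct$ is the octahedron $K_{2,2,2}$. Pick a vertex $v$ of $Oct$; its neighbours induce a 4-cycle $abcda$. $Oct_{1}^{+}$ is obtained from $Oct$ by deleting $v$ and adding two new adjacent vertices $v',v''$ with $v'$ joined to $a,b$ and $v''$ joined to $c,d$. $C_{6}^{2}$ is the square of the 6-cycle: vertex set $\mathbb{Z}_6$, $i\sim j$ iff $i-j\in\{\pm1,\pm2\}\pmod 6$. *)

(* Defs.v *)
From HB Require Import structures.
From mathcomp Require Import all_boot all_order all_algebra.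
From mathcomp Require Import all_classical all_reals all_analysis.

Set Implicit Arguments.
Unset Strict Implicit.
Unset Printing Implicit Defensive.

Import Order.TTheory GRing.Theory Num.Theory.
Import numFieldNormedType.Exports.

Record sgraph := SGraph {
  vertex :> finType;
  adj : rel vertex;
  adj_sym : symmetric adj;
  adj_irrefl : irreflexive adj }.

Definition isomorphic (G H : sgraph) : Prop :=
  exists f : G -> H, bijective f /\ {mono f : x y / adj x y}.

Definition connected_off (G : sgraph) (S : {set G}) : Prop :=
  {in ~: S &, forall x y : G,
    connect [rel u v | [&& u \notin S, v \notin S & adj u v]] x y}.

Definition k_connected (k : nat) (G : sgraph) : Prop :=
  (k < #|G|)%N /\ forall S : {set G}, (#|S| < k)%N -> connected_off S.

Section Operations.
Variable G : sgraph.

Section DelVertex.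
Variable v : G.

Definition del_vertex_rel : rel {x : G | x != v} :=
  fun x y => adj (val x) (val y).

Lemma del_vertex_sym : symmetric del_vertex_rel.
Proof. by move=> x y; apply: adj_sym. Qed.

Lemma del_vertex_irrefl : irreflexive del_vertex_rel.
Proof. by move=> x; apply: adj_irrefl. Qed.

Definition del_vertex : sgraph := SGraph del_vertex_sym del_vertex_irrefl.
End DelVertex.

Section Edge.
Variables u v : G.

Definition del_edge_rel : rel G := fun x y =>
  adj x y && ~~ ((x == u) && (y == v) || (x == v) && (y == u)).

Lemma del_edge_sym : symmetric del_edge_rel.
Proof.
move=> x y; rewrite /del_edge_rel adj_sym; congr (_ && ~~ _).
by rewrite orbC; congr (_ || _); apply: andbC.
Qed.

Lemma del_edge_irrefl : irreflexive del_edge_rel.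
Proof. by move=> x; rewrite /del_edge_rel adj_irrefl. Qed.

Definition del_edge : sgraph := SGraph del_edge_sym del_edge_irrefl.

(* Contracting [uv] merges [v] into [u]; the loop and the parallel edges that
   arise are suppressed, so that the result is again simple. *)
Definition contract_rel : rel {x : G | x != v} := fun x y =>
  (x != y) && [|| adj (val x) (val y),
                  (val x == u) && adj v (val y)
                | (val y == u) && adj v (val x)].

Lemma contract_sym : symmetric contract_rel.
Proof.
move=> x y; rewrite /contract_rel eq_sym adj_sym.
by congr (_ && (_ || _)); apply: orbC.
Qed.

Lemma contract_irrefl : irreflexive contract_rel.
Proof. by move=> x; rewrite /contract_rel eqxx. Qed.

Definition contract_edge : sgraph := SGraph contract_sym contract_irrefl.
End Edge.
End Operations.

(* [minor H G]: some sequence of operations turns [G] into a copy of [H]. *)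
Inductive minor (H : sgraph) : sgraph -> Prop :=
| minor_iso (G : sgraph) : isomorphic G H -> minor H G
| minor_del_vertex (G : sgraph) (v : G) :
    minor H (del_vertex v) -> minor H G
| minor_del_edge (G : sgraph) (u v : G) :
    adj u v -> minor H (del_edge u v) -> minor H G
| minor_contract (G : sgraph) (u v : G) :
    adj u v -> minor H (contract_edge u v) -> minor H G.

Definition minor_free (H G : sgraph) : Prop := ~ minor H G.

(* K_{2,2,2}: the colour classes are the fibres of the first projection. *)
Definition oct_rel : rel ('I_3 * bool) := fun x y => x.1 != y.1.

Lemma oct_sym : symmetric oct_rel.
Proof. by move=> x y; rewrite /oct_rel eq_sym. Qed.

Lemma oct_irrefl : irreflexive oct_rel.
Proof. by move=> x; rewrite /oct_rel eqxx. Qed.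

Definition Oct : sgraph := SGraph oct_sym oct_irrefl.

(* The neighbours of [oct_v] induce the 4-cycle a b c d a; all choices of
   [oct_v] and of the labelling are equivalent under automorphisms of [Oct]. *)
Definition oct_v : Oct := (inord 0, false).
Definition oct_a : Oct := (inord 1, false).
Definition oct_b : Oct := (inord 2, false).
Definition oct_c : Oct := (inord 1, true).
Definition oct_d : Oct := (inord 2, true).

(* [inr false] and [inr true] are the new vertices v' and v''. *)
Definition oct1p_joined (i : bool) (x : Oct) : bool :=
  x \in (if i then [:: oct_c; oct_d] else [:: oct_a; oct_b]).

Definition oct1p_rel : rel (del_vertex oct_v + bool) := fun x y =>
  match x, y with
  | inl x, inl y => adj x y
  | inl x, inr i => oct1p_joined i (val x)
  | inr i, inl y => oct1p_joined i (val y)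
  | inr i, inr j => i != j
  end.

Lemma oct1p_sym : symmetric oct1p_rel.
Proof.
move=> [x|i] [y|j] //; first exact: (@adj_sym (del_vertex _)).
by case: i j => [] [].
Qed.

Lemma oct1p_irrefl : irreflexive oct1p_rel.
Proof.
by move=> [x|i]; [apply: (@adj_irrefl (del_vertex _)) | case: i].
Qed.

Definition Oct1p : sgraph := SGraph oct1p_sym oct1p_irrefl.

Definition C62_rel : rel 'Z_6 := fun i j =>
  (i - j)%R \in [:: 1; -1; 2%:R; - 2%:R]%R.

Lemma C62_sym : symmetric C62_rel.
Proof.
move=> i j; rewrite /C62_rel !inE -![(j - i == _)%R]eqr_opp opprB !opprK orbCA.
by do 2!congr (_ || _); apply: orbC.
Qed.

Lemma C62_irrefl : irreflexive C62_rel.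
Proof. by move=> i; rewrite /C62_rel subrr. Qed.

Definition C62 : sgraph := SGraph C62_sym C62_irrefl.

Section Planarity.
Variable R : realType.
Local Open Scope classical_set_scope.
Local Open Scope ring_scope.

Definition simple_arc (A : set (R * R)) (p q : R * R) : Prop :=
  exists g : R -> R * R,
    [/\ {within `[0, 1], continuous g},
        {in `[0, 1] &, injective g},
        g 0 = p, g 1 = q & A = g @` `[0, 1]].

Variables (G : sgraph) (pos : G -> R * R) (curve : G -> G -> set (R * R)).

Definition curve_interior (x y : G) : set (R * R) :=
  [set p | [/\ curve x y p, p <> pos x & p <> pos y]].

(* [curve x y] is only meaningful for adjacent [x] and [y]. *)
Definition plane_drawing : Prop :=
  [/\ injective pos,
      forall x y, adj x y -> simple_arc (curve x y) (pos x) (pos y),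
      forall x y, adj x y -> curve x y = curve y x,
      forall x y z, adj x y -> ~ curve_interior x y (pos z) &
      forall x y x' y', adj x y -> adj x' y' ->
        ~ ((x = x' /\ y = y') \/ (x = y' /\ y = x')) ->
        curve_interior x y `&` curve x' y' = set0].
End Planarity.

Definition planar (R : realType) (G : sgraph) : Prop :=
  exists (pos : G -> R * R) (curve : G -> G -> set (R * R)),
    plane_drawing pos curve.

(* Main.v *)
(* Planarity enters through crossing parities. Approximating the curves by polygons,
   let m z x y be the parity of the number of segments of the curve xy that lie
   below the vertex z. For disjoint edges xy and zt, the xor of m x z t, m y z t,
   m z x y and m t x y depends only on the order of the four abscissae, because
   the curves do not cross. Adding such equations excludes K33 minors and yields
   the parts of the Jordan curve theorem needed below: the parity of z with
   respect to a cycle is constant along paths avoiding it, and the bridges of a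
   theta behave as in the plane.

   Fix a vertex w and choose a cycle s avoiding w with as few vertices as possible
   on the side of w, and then as short as possible. Rerouting s through a bridge or
   a chord on that side would improve it, so w sees only s, s has no chord, and by
   4-connectivity the vertices off s and w form a connected set K attached to every
   vertex of s. Hence w, K and four arcs of s are the branch sets of an Oct minor.

   Now take an Oct minor model covering G. If a branch set splits into two connected
   parts each seeing two of its four neighbours, there is an Oct1p or a K33 minor.
   Otherwise each branch set has a vertex all of whose complementary components see
   only one neighbour; moving these components makes all branch sets singletons,
   and G is Oct, which is C62. *)
Require Import Defs.
From mathcomp Require Import all_boot all_order all_algebra.
From mathcomp Require Import all_classical all_reals all_analysis.
From mathcomp Require Import ring lra zify.
Set Implicit Arguments.
Unset Strict Implicit.
Unset Printing Implicit Defensive.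
Import Order.TTheory GRing.Theory Num.Theory.
Import numFieldNormedType.Exports.

(** * Parity of crossings in the plane *)

(** The polygon sampled from a curve may cross itself, and may cross the polygons of edges that
    share an end with it. What survives the approximation is one equation modulo 2 for each pair of
    disjoint edges. All topology is therefore phrased through [m] and [l], and each planar fact is a
    sum of such equations over pairs of disjoint walks.

    Branch sets are fibres of a map defined on the whole graph, so that splitting, merging and
    moving them are mere relabellings.

    Four-connectivity acts at full strength on sets [{u, v, w}], where [u] and [v] cut the cycle
    into two arcs: with [w] deleted the graph is still 3-connected, so something other than [u] and
    [v] leaves the interior of an arc.

    An isomorphism with [C62] gives freeness by counting: [Oct1p] has seven vertices, [C62] has six,
    and minors do not gain vertices. *)

Section WalkParity.
Variables (T : Type) (m : T -> T -> T -> bool) (l : rel T).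

(** For four distinct points and a strict linear order [l], this is 1 exactly when the pairs [p],
    [q] and [r], [s] interlace. *)
Definition order_parity p q r s := l p r (+) l q r (+) l p s (+) l q s.

Definition crossing_parity p q r s :=
  m p r s (+) m q r s (+) m r p q (+) m s p q.

Fixpoint walk_parity v x s :=
  if s is y :: s' then m v x y (+) walk_parity v y s' else false.

Fixpoint steps (P : T -> T -> Prop) x s :=
  if s is y :: s' then P x y /\ steps P y s' else True.

Lemma walk_parity_cat v x s t :
  walk_parity v x (s ++ t) = walk_parity v x s (+) walk_parity v (last x s) t.
Proof. by elim: s x => //= y s IH x; rewrite IH addbA. Qed.

(** Add the equations of the fixed pair [a], [b] with the successive steps of the walk. An inner
    vertex of the walk enters two consecutive equations with the same terms, so only the terms of
    its two ends survive. *)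
Lemma walk_parity_step a b z t :
  steps (fun c d => crossing_parity a b c d = order_parity a b c d) z t ->
  walk_parity a z t (+) walk_parity b z t (+) m z a b (+) m (last z t) a b =
  order_parity a b z (last z t).
Proof.
elim: t z => [|y t IH] z /=.
  rewrite /order_parity /=.
  by move: (m z a b) (l a z) (l b z); do 3!case.
case=> e /IH; move: e; rewrite /crossing_parity /order_parity.
move: (last y t) => w.
move: (m a z y) (m b z y) (m z a b) (m y a b) (m w a b) (l a z) (l b z) (l a y)
  (l b y) (l a w) (l b w) (walk_parity a y t) (walk_parity b y t).
by do 13!case.
Qed.

Lemma walk_crossing_parity x s z t :
  steps (fun a b => steps (fun c d =>
    crossing_parity a b c d = order_parity a b c d) z t) x s ->
  walk_parity x z t (+) walk_parity (last x s) z t (+)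
  walk_parity z x s (+) walk_parity (last z t) x s =
  order_parity x (last x s) z (last z t).
Proof.
elim: s x => [|y s IH] x /=.
  rewrite /order_parity.
  by move: (walk_parity x z t) (l x z) (l x (last z t)); do 3!case.
case=> /walk_parity_step e /IH; move: e; rewrite /order_parity.
move: (last y s) (last z t) => u w.
move: (m z x y) (m w x y) (l x z) (l y z) (l x w) (l y w) (l u z) (l u w)
  (walk_parity x z t) (walk_parity y z t) (walk_parity u z t)
  (walk_parity z y s) (walk_parity w y s).
by do 13!case.
Qed.
End WalkParity.

(** * The parity equation for two disjoint segments *)

Section SegmentParity.
Local Open Scope ring_scope.
Variable R : realFieldType.
Implicit Types p q r s v : R * R.

Definition lexlt p q := (p.1 < q.1) || ((p.1 == q.1) && (p.2 < q.2)).

Definition orient p q r :=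
  (q.1 - p.1) * (r.2 - p.2) - (q.2 - p.2) * (r.1 - p.1).

(* [v] lies above the segment [pq]; ordering points lexicographically amounts to
   an infinitesimal shear that makes all abscissae distinct. *)
Definition above v p q :=
  [&& lexlt p v, lexlt v q & 0 < orient p q v] (+)
  [&& lexlt q v, lexlt v p & 0 < orient q p v].

Definition on_segment p q v :=
  exists2 a, 0 <= a <= 1 & v = ((1 - a) * p.1 + a * q.1, (1 - a) * p.2 + a * q.2).

Definition segments_disjoint p q r s :=
  forall v, on_segment p q v -> ~ on_segment r s v.

Lemma lexlt_total p q : [\/ lexlt p q, p = q | lexlt q p].
Proof.
case: p q => [p1 p2] [q1 q2]; rewrite /lexlt /=.
case: (ltgtP p1 q1) => [||->] /=; [by constructor 1 | by constructor 3 |].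
by case: (ltgtP p2 q2) => [||->]; [constructor 1 | constructor 3 | constructor 2].
Qed.

Lemma lexlt_trans : transitive lexlt.
Proof.
move=> [q1 q2] [p1 p2] [r1 r2]; rewrite /lexlt /=.
case: (ltgtP p1 q1) => //= [h _|-> h].
  by case/orP => [h'|/andP[/eqP<- _]]; rewrite ?(lt_trans h h') ?h.
by case/orP => [->//|/andP[/eqP-> h']]; rewrite eqxx (lt_trans h h') orbT.
Qed.

Lemma lexltxx p : lexlt p p = false.
Proof. by rewrite /lexlt !ltxx andbF. Qed.

Lemma lexlt_asym p q : lexlt p q -> lexlt q p = false.
Proof.
by move=> pq; apply/negP => /(lexlt_trans pq); rewrite lexltxx.
Qed.

Lemma lexltN p q : p != q -> lexlt p q = ~~ lexlt q p.
Proof.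
case: (lexlt_total p q) => [h _|->|h _]; last by rewrite h lexlt_asym.
- by rewrite h lexlt_asym.
- by rewrite eqxx.
Qed.

Lemma on_segment_line p q v : lexlt p v -> lexlt v q -> orient p q v = 0 ->
  on_segment p q v.
Proof.
case: p q v => [p1 p2] [q1 q2] [v1 v2]; rewrite /lexlt /orient /on_segment /=.
move=> pv vq o0.
have [d0|d0] := eqVneq p1 q1.
  move: pv vq; rewrite -d0 => pv vq.
  have e1 : v1 = p1 by case/orP: pv vq => [|/andP[/eqP-> //]]; case: ltgtP.
  move: pv vq; rewrite e1 !ltxx !eqxx /= => pv vq.
  have d : 0 < q2 - p2 by lra.
  exists ((v2 - p2) / (q2 - p2)).
    by rewrite divr_ge0 ?ler_pdivrMr //=; lra.
  by congr pair; field; lra.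
have l1 : p1 <= v1 by case/orP: pv => [/ltW //|/andP[/eqP-> //]].
have l2 : v1 <= q1 by case/orP: vq => [/ltW //|/andP[/eqP-> //]].
have d : 0 < q1 - p1 by rewrite subr_gt0 lt_neqAle d0 (le_trans l1).
exists ((v1 - p1) / (q1 - p1)).
  by rewrite divr_ge0 ?ler_pdivrMr //=; lra.
have e2 : v2 = p2 + (q2 - p2) * (v1 - p1) / (q1 - p1).
  by apply: (mulfI (lt0r_neq0 d)); rewrite mulrDr [_ * (_ / _)]mulrC divfK ?gt_eqF //; lra.
by rewrite e2; congr pair; field; lra.
Qed.

Lemma aboveC v p q : above v p q = above v q p.
Proof. exact: addbC. Qed.

Lemma abovexx v p : above v p p = false.
Proof. by rewrite /above; case pv : (lexlt p v); rewrite ?(lexlt_asym pv). Qed.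

Lemma above_lt v p q : lexlt p q ->
  above v p q = [&& lexlt p v, lexlt v q & 0 < orient p q v].
Proof.
move=> pq; rewrite /above; case qv : (lexlt q v); case vp : (lexlt v p);
  rewrite /= ?addbF //.
by have := lexlt_trans qv vp; rewrite lexlt_asym.
Qed.

Lemma on_segmentl p q : on_segment p q p.
Proof. exists 0; first by lra. by case: p => a b /=; congr pair; ring. Qed.

Lemma on_segmentr p q : on_segment p q q.
Proof. exists 1; first by lra. by case: q => a b /=; congr pair; ring. Qed.

Lemma lexlt_between p q r s v : lexlt p r -> lexlt s q -> lexlt r s ->
  on_segment r s v -> lexlt p v && lexlt v q.
Proof.
case: p q r s => [p1 p2] [q1 q2] [r1 r2] [s1 s2] + + + [a /andP[a0 a1] ->].
rewrite /lexlt /= => pr sq rs.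
have rs1 : r1 <= s1 by case/orP: rs => [/ltW //|/andP[/eqP-> //]].
have pr1 : p1 <= r1 by case/orP: pr => [/ltW //|/andP[/eqP-> //]].
have sq1 : s1 <= q1 by case/orP: sq => [/ltW //|/andP[/eqP-> //]].
set v1 := (1 - a) * r1 + a * s1.
have rv1 : r1 <= v1 by rewrite /v1; nra.
have vs1 : v1 <= s1 by rewrite /v1; nra.
apply/andP; split.
  case: (ltgtP p1 v1) => //= [|pv]; first by lra.
  have e : r1 = v1 by lra. have e' : p1 = r1 by lra.
  move: pr; rewrite e' ltxx eqxx /= => pr.
  case/orP: rs => [rs|/andP[_ rs]]; last by nra.
  have /eqP : a * (s1 - r1) = 0 by move: e; rewrite /v1; lra.
  by rewrite mulf_eq0 => /orP[/eqP a00|/eqP sr0]; [rewrite a00; lra|lra].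
case: (ltgtP v1 q1) => //= [|vq]; first by lra.
have e : s1 = v1 by lra. have e' : q1 = s1 by lra.
move: sq; rewrite e' ltxx eqxx /= => sq.
case/orP: rs => [rs|/andP[_ rs]]; last by nra.
have /eqP : (1 - a) * (s1 - r1) = 0 by move: e; rewrite /v1; lra.
by rewrite mulf_eq0 => /orP[/eqP a00|/eqP sr0]; [have -> : a = 1 by lra|lra]; lra.
Qed.

(** [orient p q] is affine along [rs]. If its end values [a] and [b] differed in sign, it would
    vanish at the parameter [a / (a - b)]; that point lies lexicographically between [p] and [q],
    hence on both segments. *)
Lemma nested_orient p q r s : lexlt p r -> lexlt r s -> lexlt s q ->
  segments_disjoint p q r s -> (0 < orient p q r) = (0 < orient p q s).
Proof.
move=> pr rs sq dis; apply/idP/idP => h; apply/negPn/negP; rewrite -leNgt => h'.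
  set a := orient p q r in h; set b := orient p q s in h'.
  have d : 0 < a - b by lra.
  have ab : 0 <= a / (a - b) <= 1 by rewrite divr_ge0 ?ler_pdivrMr //=; lra.
  set v := ((1 - a / (a - b)) * r.1 + a / (a - b) * s.1,
            (1 - a / (a - b)) * r.2 + a / (a - b) * s.2).
  have vrs : on_segment r s v by exists (a / (a - b)).
  have /andP[pv vq] := lexlt_between pr sq rs vrs.
  apply: dis vrs; apply: on_segment_line => //.
  have -> : orient p q v = (1 - a / (a - b)) * a + a / (a - b) * b.
    by rewrite /v /a /b /orient /=; ring.
  by field; lra.
set a := orient p q r in h'; set b := orient p q s in h.
have d : 0 < b - a by lra.
have ab : 0 <= - a / (b - a) <= 1 by rewrite divr_ge0 ?ler_pdivrMr //=; lra.
set v := ((1 - (- a / (b - a))) * r.1 + (- a / (b - a)) * s.1,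
          (1 - (- a / (b - a))) * r.2 + (- a / (b - a)) * s.2).
have vrs : on_segment r s v by exists (- a / (b - a)).
have /andP[pv vq] := lexlt_between pr sq rs vrs.
apply: dis vrs; apply: on_segment_line => //.
have -> : orient p q v = (1 - (- a / (b - a))) * a + (- a / (b - a)) * b.
  by rewrite /v /a /b /orient /=; ring.
by field; lra.
Qed.

(** [D] is the determinant of the two directions. By Cramer's rule [- d / D] and [a / D] are the
    parameters on [pq] and on [rs] of the point where the two lines meet. *)
Lemma crossing_segments p q r s (a := orient p q r) (d := orient r s p)
    (D := orient r s q - d) : D != 0 ->
  0 <= - d / D <= 1 -> 0 <= a / D <= 1 -> ~ segments_disjoint p q r s.
Proof.
move=> D0 d01 a01; set v := ((1 - (- d / D)) * p.1 + (- d / D) * q.1,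
  (1 - (- d / D)) * p.2 + (- d / D) * q.2).
move/(_ v) => dis; apply: dis; first by exists (- d / D).
exists (a / D) => //; congr pair; apply: (mulfI D0).
- have -> : D * ((1 - - d / D) * p.1 + - d / D * q.1) =
            D * p.1 - d * (q.1 - p.1) by field.
  have -> : D * ((1 - a / D) * r.1 + a / D * s.1) =
            D * r.1 + a * (s.1 - r.1) by field.
  by rewrite /D /a /d /orient; ring.
- have -> : D * ((1 - - d / D) * p.2 + - d / D * q.2) =
            D * p.2 - d * (q.2 - p.2) by field.
  have -> : D * ((1 - a / D) * r.2 + a / D * s.2) =
            D * r.2 + a * (s.2 - r.2) by field.
  by rewrite /D /a /d /orient; ring.
Qed.

(** If [a] and [c] had the same sign, then by [E1] and [E2] the orientations [b] and [d] would have
    the opposite one. Each line would then separate the ends of the other segment, and the segments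
    would meet. *)
Lemma interlaced_orient p q r s : lexlt p r -> lexlt r q -> lexlt q s ->
  segments_disjoint p q r s -> (0 < orient r s q) = ~~ (0 < orient p q r).
Proof.
move=> pr rq qs dis.
have a0 : orient p q r != 0.
  apply/eqP => /(on_segment_line pr rq) h.
  by apply: (dis r) => //; apply: on_segmentl.
have c0 : orient r s q != 0.
  apply/eqP => /(on_segment_line rq qs) h.
  by apply: (dis q) => //; apply: on_segmentr.
have le1 x y : lexlt x y -> x.1 <= y.1.
  by case/orP => [/ltW //|/andP[/eqP-> //]].
move: (le1 _ _ pr) (le1 _ _ rq) (le1 _ _ qs) => pr1 rq1 qs1.
set a := orient p q r in a0 *; set c := orient r s q in c0 *.
pose b := orient p q s; pose d := orient r s p.
have E1 : (s.1 - q.1) * a + (q.1 - r.1) * b = - ((q.1 - p.1) * c).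
  by rewrite /a /b /c /orient; ring.
have E2 : (q.1 - r.1) * d + (r.1 - p.1) * c = - ((s.1 - r.1) * a).
  by rewrite /a /d /c /orient; ring.
have E3 : c - d = a - b by rewrite /a /b /c /d /orient; ring.
have pq1 : p.1 < q.1.
  rewrite lt_neqAle (le_trans pr1 rq1) andbT; apply/eqP => e.
  have er : r.1 = p.1 by lra.
  by move/eqP: a0; apply; rewrite /a /orient er e !subrr !mul0r mulr0 subr0.
have rs1 : r.1 < s.1.
  rewrite lt_neqAle (le_trans rq1 qs1) andbT; apply/eqP => e.
  have er : q.1 = s.1 by lra.
  by move/eqP: c0; apply; rewrite /c /orient -e er -e !subrr !mul0r mulr0 subr0.
apply/idP/idP => h.
  apply/negP => h'.
  have bneg : b < 0 by nra.
  have dneg : d < 0 by nra.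
  have D0 : 0 < c - d by lra.
  apply: (@crossing_segments p q r s) dis; rewrite -/a -/c -/d ?gt_eqF //.
    by rewrite divr_ge0 ?ler_pdivrMr //=; lra.
  by rewrite divr_ge0 ?ler_pdivrMr //=; lra.
rewrite ltNge le_eqVlt (negPf c0) /=; apply/negP => cneg.
have aneg : a < 0 by rewrite lt_neqAle a0 leNgt.
have bpos : 0 < b by nra.
have dpos : 0 < d by nra.
have D0 : c - d < 0 by lra.
apply: (@crossing_segments p q r s) dis; rewrite -/a -/c -/d ?lt_eqF //.
  by rewrite -[- d / _]mulrNN -invrN opprK divr_ge0 ?ler_pdivrMr //=; lra.
by rewrite -[a / _]mulrNN -invrN divr_ge0 ?ler_pdivrMr //=; lra.
Qed.

Lemma segments_disjointC p q r s :
  segments_disjoint p q r s -> segments_disjoint r s p q.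
Proof. by move=> dis v h1 h2; apply: (dis v). Qed.

Lemma on_segmentC p q v : on_segment p q v -> on_segment q p v.
Proof.
by move=> [a a01 ->]; exists (1 - a); [lra | congr pair; ring].
Qed.

Lemma segments_disjointCl p q r s :
  segments_disjoint p q r s -> segments_disjoint q p r s.
Proof. by move=> dis v /on_segmentC; apply: dis. Qed.

Lemma sorted_segment_parity p q r s :
  lexlt p q -> lexlt r s -> lexlt p r -> segments_disjoint p q r s ->
  crossing_parity above p q r s = order_parity lexlt p q r s.
Proof.
move=> pq rs pr dis; have ps := lexlt_trans pr rs.
rewrite /crossing_parity /order_parity !above_lt // pr ps (lexlt_asym pr) /=.
have neq x y : on_segment p q x -> on_segment r s y -> x != y.
  by move=> h h'; apply/eqP => e; apply: (dis x) => //; rewrite e.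
have qr : q != r by apply: neq; [exact: on_segmentr|exact: on_segmentl].
have qs : q != s by apply: neq; exact: on_segmentr.
rewrite (lexltN qr) (lexltN qs).
case rq : (lexlt r q) => /=; case sq : (lexlt s q) => //=.
- by rewrite (nested_orient pr rs sq) // addbb.
- have qs' : lexlt q s by rewrite (lexltN qs) sq.
  by rewrite (interlaced_orient pr rq qs') // addbF addNb addbb.
- by move: rq; rewrite (lexlt_trans rs sq).
Qed.

Lemma segment_parity p q r s : segments_disjoint p q r s ->
  crossing_parity above p q r s = order_parity lexlt p q r s.
Proof.
wlog pq : p q / lexlt p q => [W dis|].
  case: (lexlt_total p q) => [pq|e|qp]; first exact: W.
    rewrite /crossing_parity /order_parity e.
    rewrite !abovexx; move: (above q r s) (lexlt q r) (lexlt q s).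
    by do 3!case.
  have := W q p qp (segments_disjointCl dis).
  rewrite /crossing_parity /order_parity !(aboveC _ p q) => h.
  rewrite [above p r s (+) _]addbC h.
  by rewrite [lexlt p r (+) _]addbC -!addbA [lexlt p s (+) _]addbC.
wlog rs : r s / lexlt r s => [W dis|].
  case: (lexlt_total r s) => [rs|e|sr]; first exact: W.
    rewrite /crossing_parity /order_parity e !abovexx.
    move: (above s p q) (lexlt p s) (lexlt q s).
    by do 3!case.
  have dis' : segments_disjoint p q s r.
    by apply/segments_disjointC/segments_disjointCl/segments_disjointC.
  have := W s r sr dis'; rewrite /crossing_parity /order_parity !(aboveC _ r s).
  move: (above _ _ _) (above _ _ _) (above _ _ _) (above _ _ _) (lexlt _ _) (lexlt _ _) (lexlt _ _) (lexlt _ _).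
  by do 8!case.
move=> dis.
have pr : p != r.
  apply/eqP => e; apply: (dis p); first exact: on_segmentl.
  by rewrite e; exact: on_segmentl.
case: (lexlt_total p r) => [pr'|/eqP|rp]; last 1 first.
- have := sorted_segment_parity rs pq rp (segments_disjointC dis).
  have neq x y : on_segment p q x -> on_segment r s y -> x != y.
    by move=> h h'; apply/eqP => e; apply: (dis x) => //; rewrite e.
  have L := on_segmentl; have RR := on_segmentr.
  rewrite /crossing_parity /order_parity (lexltN (neq p r _ _)) //.
  rewrite (lexltN (neq q r _ _)) // (lexltN (neq p s _ _)) //.
  rewrite (lexltN (neq q s _ _)) //.
  move: (above _ _ _) (above _ _ _) (above _ _ _) (above _ _ _) (lexlt _ _) (lexlt _ _) (lexlt _ _) (lexlt _ _).
  by do 8!case.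
- exact: sorted_segment_parity.
- by rewrite (negPf pr).
Qed.
End SegmentParity.

(** * Polygonal approximation of disjoint curves *)

Section Sampling.
Local Open Scope classical_set_scope.
Local Open Scope ring_scope.
Variable R : realType.
Implicit Types g h : R -> R * R.

Lemma within_unit_continuous g (s e : R) :
  {within `[0, 1], continuous g} -> 0 <= s <= 1 -> 0 < e ->
  exists2 a : R, 0 < a & forall t, 0 <= t <= 1 -> `|s - t| < a ->
    `|(g s).1 - (g t).1| < e /\ `|(g s).2 - (g t).2| < e.
Proof.
move=> cg s01 e0; have := cg s.
move/(_ (ball (g s) e)) => /(_ (nbhsx_ballx _ _ e0)).
rewrite /nbhs /= -nbhs_subspace_in; last by rewrite /= in_itv.
rewrite /within /= => /nbhs_ballP[a /= a0 ha].
by exists a => // t t01 st; have := ha t st; rewrite /= in_itv; apply.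
Qed.

Lemma near_segments_disjoint (p q u1 u2 w1 w2 : R * R) e :
  (forall x, x \in [:: u1; u2] -> `|p.1 - x.1| < e /\ `|p.2 - x.2| < e) ->
  (forall x, x \in [:: w1; w2] -> `|q.1 - x.1| < e /\ `|q.2 - x.2| < e) ->
  2 * e <= `|p.1 - q.1| \/ 2 * e <= `|p.2 - q.2| ->
  segments_disjoint u1 u2 w1 w2.
Proof.
move=> hu hw pq v [a /andP[a0 a1] ->] [b /andP[b0 b1] []].
have [] := hu u1 _; first by rewrite inE eqxx.
have [] := hu u2 _; first by rewrite !inE eqxx orbT.
have [] := hw w1 _; first by rewrite inE eqxx.
have [] := hw w2 _; first by rewrite !inE eqxx orbT.
have conv (x y1 y2 c : R) : 0 <= c -> c <= 1 -> `|x - y1| < e ->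
    `|x - y2| < e -> `|x - ((1 - c) * y1 + c * y2)| < e.
  move=> c0 c1; rewrite !ltr_norml => /andP[h1 h2] /andP[h3 h4].
  have [->|cn0] := eqVneq c 0; first by apply/andP; split; lra.
  have cp : 0 < c by rewrite lt_neqAle eq_sym cn0.
  by apply/andP; split; nra.
move=> w21 w22 w11 w12 u21 u22 u11 u12 e1 e2.
case: pq => d.
  have := conv _ _ _ _ a0 a1 u11 u21; have := conv _ _ _ _ b0 b1 w11 w21.
  rewrite e1 !ltr_norml => /andP[? ?] /andP[? ?].
  by move: d; apply/negP; rewrite -ltNge ltr_norml; apply/andP; split; lra.
have := conv _ _ _ _ a0 a1 u12 u22; have := conv _ _ _ _ b0 b1 w12 w22.
rewrite e2 !ltr_norml => /andP[? ?] /andP[? ?].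
by move: d; apply/negP; rewrite -ltNge ltr_norml; apply/andP; split; lra.
Qed.

(** Near a pair of parameters the chords stay in two disjoint boxes around the distinct points [g s]
    and [h t]. Compactness of the unit square makes the admissible mesh uniform. *)
Lemma disjoint_curves_mesh g h :
  {within `[0, 1], continuous g} -> {within `[0, 1], continuous h} ->
  (forall s t, 0 <= s <= 1 -> 0 <= t <= 1 -> g s <> h t) ->
  exists2 d : R, 0 < d & forall s1 s2 t1 t2,
    0 <= s1 <= 1 -> 0 <= s2 <= 1 -> 0 <= t1 <= 1 -> 0 <= t2 <= 1 ->
    `|s1 - s2| < d -> `|t1 - t2| < d ->
    segments_disjoint (g s1) (g s2) (h t1) (h t2).
Proof.
move=> cg ch dis.
pose K := (`[(0:R), 1] `*` `[(0:R), 1])%classic.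
have cK : compact K by apply: compact_setX; apply: segment_compact.
pose P (e : R) (st : R * R) := forall s2 t2, 0 <= s2 <= 1 -> 0 <= t2 <= 1 ->
  `|st.1 - s2| < e -> `|st.2 - t2| < e ->
  segments_disjoint (g st.1) (g s2) (h st.2) (h t2).
have : \forall e \near 0^'+, K `<=` P e.
  move/compact_near_coveringP/near_covering_withinP : cK; apply.
  case=> s t [/=]; rewrite !in_itv /= => s01 t01.
  have [e e0 he] : exists2 e : R, 0 < e & 2 * e <= `|(g s).1 - (h t).1| \/
      2 * e <= `|(g s).2 - (h t).2|.
    have [e1|n1] := eqVneq (g s).1 (h t).1; last first.
      exists (`|(g s).1 - (h t).1| / 2); last by left; lra.
      by rewrite divr_gt0 // normr_gt0 subr_eq0.
    have n2 : (g s).2 != (h t).2.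
      apply/eqP => e2; apply: (dis s t) => //.
      by rewrite [g s]surjective_pairing e1 e2 -surjective_pairing.
    exists (`|(g s).2 - (h t).2| / 2); last by right; lra.
    by rewrite divr_gt0 // normr_gt0 subr_eq0.
  have [a a0 ha] := within_unit_continuous cg s01 e0.
  have [b b0 hb] := within_unit_continuous ch t01 e0.
  (* The half is there because the second end of a chord is reached in two steps, from [s] to the
     first parameter and from there to the second. *)
  pose r := Num.min a b / 2.
  have r0 : 0 < r by rewrite divr_gt0 // lt_min a0.
  have ra : 2 * r <= a by rewrite /r mulrC divfK // ge_min lexx.
  have rb : 2 * r <= b by rewrite /r mulrC divfK // ge_min lexx orbT.
  have near2 (x y z : R) : `|x - y| < r -> `|y - z| < r -> `|x - z| < 2 * r.
    by rewrite !ltr_norml => /andP[? ?] /andP[? ?]; apply/andP; split; lra.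
  near=> x d; rewrite /P.
  have dr : d < r by near: d; apply: nbhs_right_lt.
  have [xs xt] : `|s - x.1| < r /\ `|t - x.2| < r.
    by near: x; apply: (nbhsx_ballx (s, t) r).
  case=> /=; rewrite !in_itv /= => x101 x201 s2 t2 s201 t201 xs2 xt2.
  have w1 (y : R) : `|y| < r -> `|y| < 2 * r by move=> ?; lra.
  apply: (@near_segments_disjoint (g s) (h t) _ _ _ _ e) he.
  - move=> y; rewrite !inE => /orP[] /eqP->; apply: ha => //.
      exact: lt_le_trans (w1 _ xs) ra.
    exact: lt_le_trans (near2 _ _ _ xs (lt_trans xs2 dr)) ra.
  - move=> y; rewrite !inE => /orP[] /eqP->; apply: hb => //.
      exact: lt_le_trans (w1 _ xt) rb.
    exact: lt_le_trans (near2 _ _ _ xt (lt_trans xt2 dr)) rb.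
move=> hK.
have [d [d0 hd]] : exists d, 0 < d /\ K `<=` P d.
  have h0 : \forall e \near 0^'+, (0 : R) < e by apply: nbhs_right_gt.
  have [d [? ?]] := filter_ex (filterI h0 hK).
  by exists d.
exists d => // s1 s2 t1 t2 s101 s201 t101 t201.
by apply: (hd (s1, t1)) => //=; rewrite !in_itv.
Unshelve. all: by end_near.
Qed.

Definition sample g n i := g (i%:R / n%:R).
Definition polyline g n := [seq sample g n i | i <- iota 1 n].

Lemma sample0 g n : sample g n 0 = g 0.
Proof. by rewrite /sample mul0r. Qed.

Lemma last_polyline g n : (0 < n)%N -> last (g 0) (polyline g n) = g 1.
Proof.
case: n => // n _; rewrite -(sample0 g n.+1) /polyline last_map.
by rewrite -addn1 iotaD last_cat /= add1n addn1 /sample divff ?pnatr_eq0.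
Qed.

Lemma steps_map_iota (T : Type) (P : T -> T -> Prop) (f : nat -> T) m n :
  (forall i, (m <= i < m + n)%N -> P (f i) (f i.+1)) ->
  steps P (f m) [seq f i | i <- iota m.+1 n].
Proof.
elim: n m => //= n IH m hf; split; first by apply: hf; lia.
by apply: IH => i hi; apply: hf; lia.
Qed.

Definition curve_parity g n v := walk_parity (@above R) v (g 0) (polyline g n).

(** A threshold is given instead of a single [n], so that one mesh can later serve all pairs of
    edges at once. *)
Lemma disjoint_curves_parity g h :
  {within `[0, 1], continuous g} -> {within `[0, 1], continuous h} ->
  (forall s t, 0 <= s <= 1 -> 0 <= t <= 1 -> g s <> h t) ->
  exists N, forall n, (N < n)%N ->
    curve_parity h n (g 0) (+) curve_parity h n (g 1) (+)
    curve_parity g n (h 0) (+) curve_parity g n (h 1) =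
    order_parity (@lexlt R) (g 0) (g 1) (h 0) (h 1).
Proof.
move=> cg ch dis; have [d d0 hd] := disjoint_curves_mesh cg ch dis.
exists (Num.bound d^-1) => n Nn.
have n0 : (0 < n)%N by apply: leq_ltn_trans Nn.
have np : (0 : R) < n%:R by rewrite ltr0n.
have mesh : n%:R^-1 < d.
  rewrite -[d]invrK ltf_pV2 ?posrE ?invr_gt0 //.
  apply: lt_trans (archi_boundP _) _; first by rewrite invr_ge0 ltW.
  by rewrite ltr_nat.
rewrite -(last_polyline g n0) -(last_polyline h n0).
apply: walk_crossing_parity.
rewrite -(sample0 g n) -(sample0 h n).
have unit i : (i <= n)%N -> 0 <= (i%:R / n%:R : R) <= 1.
  by move=> hi; rewrite divr_ge0 // ler_pdivrMr // mul1r ler_nat.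
have step i : `|i%:R / n%:R - i.+1%:R / n%:R : R| < d.
  rewrite -mulrBl -natr1 opprD addrA subrr add0r mulN1r normrN.
  by rewrite gtr0_norm ?invr_gt0.
apply: steps_map_iota => i hi; apply: steps_map_iota => j hj.
by apply: segment_parity; apply: hd; rewrite ?unit ?step //; lia.
Qed.
End Sampling.

(** * From a plane drawing to parities on vertices and edges *)

Section PlanarParity.
Local Open Scope classical_set_scope.
Variables (R : realType) (G : sgraph).

Theorem planar_parity : planar R G ->
  exists (m : G -> G -> G -> bool) (l : rel G),
    [/\ forall z x y, m z x y = m z y x,
        forall x y, x != y -> l x y = ~~ l y x &
        forall x y z t, adj x y -> adj z t ->
          x \notin [:: z; t] -> y \notin [:: z; t] ->
          crossing_parity m x y z t = order_parity l x y z t].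
Proof.
case=> pos [curve [pos_inj arcs curveC avoid cross]].
have arcP (e : G * G) : {g : R -> R * R | adj e.1 e.2 ->
    [/\ {within `[0%R, 1%R], continuous g}, g 0%R = pos e.1,
        g 1%R = pos e.2 & curve e.1 e.2 = (g @` `[0%R, 1%R])%classic]}.
  apply: cid; case exy : (adj e.1 e.2); last by exists (fun _ => (0, 0)%R).
  by have [g [? ? ? ? ?]] := arcs _ _ exy; exists g.
pose g x y := sval (arcP (x, y)).
have gP x y : adj x y -> [/\ {within `[0%R, 1%R], continuous g x y},
    g x y 0%R = pos x, g x y 1%R = pos y &
    forall s, (0 <= s <= 1)%R -> curve x y (g x y s)].
  move=> xy; have [cg g0 g1 /= gxy] := svalP (arcP (x, y)) xy.
  split=> // s s01; rewrite gxy.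
  by exists s; rewrite //= in_itv.
have dis x y z t : adj x y -> adj z t ->
    x \notin [:: z; t] -> y \notin [:: z; t] ->
    forall s u, (0 <= s <= 1)%R -> (0 <= u <= 1)%R -> g x y s <> g z t u.
  move=> xy zt; rewrite !inE !negb_or => /andP[xz xt] /andP[yz yt] s u s01 u01 e.
  have [_ _ _ /(_ _ s01) cs] := gP _ _ xy.
  have [_ _ _ /(_ _ u01) cu] := gP _ _ zt.
  have npos w : w \in [:: x; y] -> g x y s <> pos w.
    move=> hw ew; apply: (avoid z t w zt); split; first by rewrite -ew e.
      by move/pos_inj => h; move: hw xz yz; rewrite -h !inE => /orP[] /eqP->; rewrite eqxx.
    by move/pos_inj => h; move: hw xt yt; rewrite -h !inE => /orP[] /eqP->; rewrite eqxx.
  have : (curve_interior pos curve x y `&` curve z t)%classic (g x y s).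
    split; last by rewrite e.
    by split=> //; apply: npos; rewrite !inE eqxx ?orbT.
  rewrite (cross x y z t xy zt) // => -[] [h1 h2].
    by rewrite h1 eqxx in xz.
  by rewrite h1 eqxx in xt.
have NP (e : G * G * (G * G)) : {N | adj e.1.1 e.1.2 -> adj e.2.1 e.2.2 ->
    e.1.1 \notin [:: e.2.1; e.2.2] -> e.1.2 \notin [:: e.2.1; e.2.2] ->
    forall n, (N < n)%N ->
    crossing_parity (fun v p q => curve_parity (g p q) n (pos v))
      e.1.1 e.1.2 e.2.1 e.2.2 =
    order_parity (fun p q => lexlt (pos p) (pos q))
      e.1.1 e.1.2 e.2.1 e.2.2}.
  apply: cid; case: e => [[x y] [z t]] /=.
  have [/and4P[xy zt nx ny]|nh] :=
    boolP [&& adj x y, adj z t, x \notin [:: z; t] & y \notin [:: z; t]].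
    have [[cxy gx gy _] [czt gz gt _]] := (gP x y xy, gP z t zt).
    have [N hN] := disjoint_curves_parity cxy czt (dis x y z t xy zt nx ny).
    exists N => _ _ _ _ n /hN; rewrite /crossing_parity /order_parity.
    by rewrite gx gy gz gt.
  by exists 0 => h1 h2 h3 h4; rewrite h1 h2 h3 h4 in nh.
(* There are finitely many pairs of edges, so a single mesh lies beyond all their thresholds. *)
pose n := (\max_e sval (NP e)).+1.
pose M z x y := curve_parity (g x y) n (pos z).
have MP x y z t : adj x y -> adj z t ->
    x \notin [:: z; t] -> y \notin [:: z; t] ->
    crossing_parity M x y z t =
    order_parity (fun p q => lexlt (pos p) (pos q)) x y z t.
  move=> xy zt nx ny; apply: (svalP (NP ((x, y), (z, t)))) => //=.
  by rewrite ltnS; apply: (leq_bigmax (F := fun e => sval (NP e)) (x, y, (z, t))).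
(* The parametrisations chosen for [xy] and for [yx] need not be reverses of each other. To make [m]
   symmetric, both read the curve that starts at the end of smaller rank. *)
exists (fun z x y => if enum_rank x < enum_rank y then M z x y else M z y x).
exists (fun p q => lexlt (pos p) (pos q)); split.
- move=> z x y; case: ltngtP => // /val_inj/enum_rank_inj-> //.
- by move=> x y xy; rewrite lexltN // (inj_eq pos_inj).
move=> x y z t xy zt nx ny.
have nx' : x \notin [:: t; z] by move: nx; rewrite !inE orbC.
have ny' : y \notin [:: t; z] by move: ny; rewrite !inE orbC.
have yx : adj y x by rewrite adj_sym. have tz : adj t z by rewrite adj_sym.
rewrite /crossing_parity; case: (enum_rank x < _); case: (enum_rank z < _).
- exact: MP.
- have := MP x y t z xy tz nx' ny'; rewrite /crossing_parity /order_parity.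
  move: (M _ _ _) (M _ _ _) (M _ _ _) (M _ _ _) (lexlt _ _) (lexlt _ _)
    (lexlt _ _) (lexlt _ _); by do 8!case.
- have := MP y x z t yx zt ny nx; rewrite /crossing_parity /order_parity.
  move: (M _ _ _) (M _ _ _) (M _ _ _) (M _ _ _) (lexlt _ _) (lexlt _ _)
    (lexlt _ _) (lexlt _ _); by do 8!case.
- have := MP y x t z yx tz ny' nx'; rewrite /crossing_parity /order_parity.
  move: (M _ _ _) (M _ _ _) (M _ _ _) (M _ _ _) (lexlt _ _) (lexlt _ _)
    (lexlt _ _) (lexlt _ _); by do 8!case.
Qed.
End PlanarParity.

(* The classical libraries shadow finite-set notations and lemma names. *)
From mathcomp Require Import all_boot all_order all_algebra.

(** * Parities in plane graphs and minor models *)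

Lemma uniq_count_le1 (T : eqType) (s : seq T) y :
  uniq s -> count_mem y s <= 1.
Proof. by move=> us; rewrite count_uniq_mem // leq_b1. Qed.

Lemma xor8_sum (a b c d e f g h : bool) :
  a (+) b (+) c (+) d = e (+) f (+) g (+) h ->
  exists k : nat, a + b + c + d + e + f + g + h = 2 * k.
Proof.
move=> eq; exists (a + b + c + d + e + f + g + h)./2.
have : ~~ odd (a + b + c + d + e + f + g + h).
  rewrite !oddD !oddb; move: eq.
  by case: a b c d e f g h => [] [] [] [] [] [] [] [].
lia.
Qed.

Lemma addb_nat (a b : bool) : exists k, (a (+) b) + 2 * k = a + b.
Proof. by exists (a && b); case: a b => [] []. Qed.

Ltac generalize_nats := repeat match goal with
  | |- context [nat_of_bool ?b] => generalize (nat_of_bool b)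
  | |- context [count ?p ?s] => generalize (count p s)
  end.

Lemma bool_eq1 (b : bool) : (nat_of_bool b = 0 -> False) -> b = true.
Proof. by case: b => // /(_ erefl). Qed.

(* Solves linear systems over the field with two elements. *)
Ltac xor_lia := apply: bool_eq1; repeat match goal with
  | H : context [nat_of_bool _] |- _ => move: H end;
  repeat match goal with |- context [nat_of_bool (?a (+) ?b)] =>
    case: (addb_nat a b); generalize (nat_of_bool (a (+) b)) end;
  generalize_nats; clear; lia.

Section Models.
Variables (G : sgraph) (L : eqType) (e : rel L) (f : G -> L).
Implicit Types (x y : G) (s : seq G).

Definition fiber_rel : rel G := [rel u v | (f u == f v) && adj u v].

(* The fibres of [f] are the branch sets of a minor model covering all of [G]. *)
Definition model :=
  [/\ forall h, exists x, f x = h,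
      forall x y, f x = f y -> connect fiber_rel x y &
      forall h h', e h h' -> exists x y, [/\ f x = h, f y = h' & adj x y]].

Lemma fiber_path x s : path fiber_rel x s ->
  path (@adj _) x s && all [pred z | f z == f x] s.
Proof.
elim: s x => //= y s IH x /andP[/andP[/eqP fxy xy] /IH/andP[-> h]].
by rewrite xy fxy eqxx /= -fxy in h *.
Qed.

Lemma model_walk x y : model -> e (f x) (f y) ->
  exists s, [/\ path (@adj _) x s, last x s = y &
    all [pred z | f z \in [:: f x; f y]] s].
Proof.
case=> _ conn edge /edge[u [v [fu fv uv]]].
have /connectP[s /fiber_path/andP[ps as_] us] := conn _ _ (esym fu).
have /connectP[t /fiber_path/andP[pt at_] yt] := conn _ _ fv.
exists (s ++ v :: t); split.
- by rewrite cat_path ps /= -us uv pt.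
- by rewrite last_cat /= yt.
rewrite all_cat /= fv !inE eqxx orbT /=; apply/andP; split.
  by apply: sub_all as_ => z /= /eqP->; rewrite inE eqxx.
by apply: sub_all at_ => z /= /eqP->; rewrite fv !inE eqxx orbT.
Qed.
End Models.

(** * Combinatorial consequences of the parity equations *)

Section GraphParity.
Variables (G : sgraph) (m : G -> G -> G -> bool) (l : rel G).
Hypothesis mC : forall z x y, m z x y = m z y x.
Hypothesis lN : forall x y, x != y -> l x y = ~~ l y x.
Hypothesis mP : forall x y z t, adj x y -> adj z t ->
  x \notin [:: z; t] -> y \notin [:: z; t] ->
  crossing_parity m x y z t = order_parity l x y z t.

Implicit Types (x y z u v : G) (s t : seq G).
Notation wp := (walk_parity m).

Lemma steps_path (e : rel G) (P : G -> G -> Prop) x s :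
  (forall u v, u \in x :: s -> v \in x :: s -> e u v -> P u v) ->
  path e x s -> steps P x s.
Proof.
elim: s x => //= y s IH x h /andP[exy ps]; split.
  by apply: h; rewrite // !inE eqxx ?orbT.
apply: IH => // u v hu hv; apply: h; rewrite inE ?hu ?hv orbT //.
Qed.

Lemma walk_crossing x s z t : path (@adj _) x s -> path (@adj _) z t ->
  (forall y, y \in x :: s -> y \in z :: t -> False) ->
  wp x z t (+) wp (last x s) z t (+) wp z x s (+) wp (last z t) x s =
  order_parity l x (last x s) z (last z t).
Proof.
move=> ps pt dis; apply: walk_crossing_parity.
apply: (steps_path _ ps) => a b ha hb ab.
apply: (steps_path _ pt) => c d hc hd cd.
apply: mP => //; rewrite !inE negb_or.
  by apply/andP; split; apply/eqP => e; [apply: (dis c)|apply: (dis d)];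
    rewrite // -e.
by apply/andP; split; apply/eqP => e; [apply: (dis c)|apply: (dis d)];
  rewrite // -e.
Qed.

Lemma walk_parity_rev v x s :
  wp v (last x s) (rev (belast x s)) = wp v x s.
Proof.
elim: s x => //= y s IH x; rewrite rev_cons -cats1 walk_parity_cat IH.
have -> : last (last y s) (rev (belast y s)) = y.
  by case: s {IH} => //= z s; rewrite rev_cons last_rcons.
by rewrite /= addbF mC addbC.
Qed.

(** In a drawing [m] counts what lies below [v], so this is the ray-casting test: it tells on which
    side of the closed walk a vertex off it lies. *)
Definition cycle_parity v s :=
  if s is x :: s' then wp v x (rcons s' x) else false.

Lemma cycle_parity_rot v s t :
  cycle_parity v (s ++ t) = cycle_parity v (t ++ s).
Proof.
case: s t => [|x s] [|y t] /=; rewrite ?cats0 //.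
rewrite -!cats1 -!catA /= !walk_parity_cat /= !walk_parity_cat /= !addbF.
move: (wp v x s) (m v (last x s) y) (wp v y t) (m v (last y t) x).
by do 4!case.
Qed.

(** In the equation of a walk with a closed walk, the two ends of the latter coincide and their
    terms cancel. What remains compares the two ends of the other walk. *)
Lemma cycle_parity_const x s y t : path (@adj _) y t ->
  cycle (@adj _) (x :: s) -> (forall z, z \in x :: s -> z \in y :: t -> False) ->
  cycle_parity y (x :: s) = cycle_parity (last y t) (x :: s).
Proof.
move=> pt cs dis; have := walk_crossing cs pt.
rewrite last_rcons => h; have {}h := h _.
have/h : forall z, z \in x :: rcons s x -> z \in y :: t -> False.
  by move=> z zs; apply: dis; move: zs; rewrite !(inE, mem_rcons) orbA orbb.
rewrite /order_parity /cycle_parity.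
move: (wp x _ _) (wp y _ _) (wp (last y t) _ _) (l _ _) (l _ _).
by do 5!case.
Qed.

Lemma walk_crossing_sum x s z t :
  path (@adj _) x s -> path (@adj _) z t ->
  (forall y, y \in x :: s -> y \in z :: t -> False) ->
  exists k : nat, wp x z t + wp (last x s) z t + wp z x s + wp (last z t) x s +
    l x z + l (last x s) z + l x (last z t) + l (last x s) (last z t) = 2 * k.
Proof.
by move=> ps pt dis; apply: xor8_sum; apply: walk_crossing.
Qed.

Lemma order_sum x y : x != y -> l x y + l y x = 1.
Proof. by move/lN->; case: (l y x). Qed.

Ltac walk_disjoint U := let y := fresh "y" in
  move=> y; rewrite -!has_pred1 !has_count; have := uniq_count_le1 y U;
  rewrite /= -?cats1 ?count_cat /= ?count_cat /= ?count_cat /=;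
  generalize_nats; clear; lia.

Ltac uniq_neq U y := let e := fresh "e" in
  apply/eqP => e; have := uniq_count_le1 y U;
  rewrite /= ?count_cat /= ?count_cat /= ?count_cat /= e eqxx /=;
  generalize_nats; clear; lia.

Lemma path_mid (e : rel G) u x v s t :
  path e u (rcons (s ++ x :: t) v) =
  path e u (rcons s x) && path e x (rcons t v).
Proof. by rewrite rcons_cat rcons_cons cat_path /= (rcons_path _ _ s) andbA. Qed.

Lemma walk_parity_mid z u x v s t :
  wp z u (rcons (s ++ x :: t) v) = wp z u (rcons s x) (+) wp z x (rcons t v).
Proof.
by rewrite rcons_cat rcons_cons -(cats1 s) !walk_parity_cat /= addbF addbA.
Qed.

Lemma cycle_parity2 z u v s t :
  cycle_parity z (u :: s ++ v :: t) = wp z u (rcons s v) (+) wp z v (rcons t u).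
Proof. exact: walk_parity_mid. Qed.

Lemma walk_parity_rcons_rev z u v s :
  wp z v (rcons (rev s) u) = wp z u (rcons s v).
Proof.
by rewrite -(walk_parity_rev z u (rcons s v)) last_rcons belast_rcons rev_cons.
Qed.

(** Parity form of a fact on plane thetas: exactly one of the three paths runs inside the cycle
    formed by the other two. Cutting the paths at [x1], [x2], [x3] leaves six pairs of halves that
    come from different paths and end at different branch vertices; their six equations add up to
    the claim. *)
Lemma theta_parity u v x1 x2 x3 (a1 a2 b1 b2 c1 c2 : seq G)
    (a := a1 ++ x1 :: a2) (b := b1 ++ x2 :: b2) (c := c1 ++ x3 :: c2) :
  uniq (u :: v :: a ++ b ++ c) ->
  path (@adj _) u (rcons a v) -> path (@adj _) v (rcons b u) ->
  path (@adj _) u (rcons c v) ->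
  cycle_parity x1 (u :: c ++ v :: b) (+)
  cycle_parity x2 (u :: a ++ v :: rev c) (+)
  cycle_parity x3 (u :: a ++ v :: b) = true.
Proof.
move=> U; rewrite !path_mid => /andP[e1 e2] /andP[f1 f2] /andP[g1 g2].
rewrite /a /b /c in U *.
case: (walk_crossing_sum e1 f1) => [|? H1]; first by walk_disjoint U.
case: (walk_crossing_sum e1 g2) => [|? H2]; first by walk_disjoint U.
case: (walk_crossing_sum e2 f2) => [|? H3]; first by walk_disjoint U.
case: (walk_crossing_sum e2 g1) => [|? H4]; first by walk_disjoint U.
case: (walk_crossing_sum f1 g1) => [|? H5]; first by walk_disjoint U.
case: (walk_crossing_sum f2 g2) => [|? H6]; first by walk_disjoint U.
move: H1 H2 H3 H4 H5 H6; rewrite !last_rcons !cycle_parity2.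
rewrite !walk_parity_rcons_rev !walk_parity_mid => H1 H2 H3 H4 H5 H6.
have uv : u != v by uniq_neq U v.
have ux2 : u != x2 by uniq_neq U x2.
have vx2 : v != x2 by uniq_neq U x2.
move: (order_sum uv) (order_sum ux2) (order_sum vx2) => ? ? ?.
xor_lia.
Qed.

(** Two interlacing chords of a plane cycle run on different sides: the first two terms record the
    side of [uv], the last two that of [pq]. The cycle with both chords is a subdivision of K4, and
    its three pairs of opposite edges give the three equations. *)
Lemma cycle_orderings_parity u p v q (a1 a2 b1 b2 : seq G) :
  uniq (u :: a1 ++ p :: a2 ++ v :: b1 ++ q :: b2) ->
  cycle (@adj _) (u :: a1 ++ p :: a2 ++ v :: b1 ++ q :: b2) ->
  adj u v -> adj p q ->
  cycle_parity p (u :: v :: b1 ++ q :: b2) (+)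
  cycle_parity q (u :: a1 ++ p :: a2 ++ [:: v]) (+)
  (cycle_parity v (p :: q :: b2 ++ u :: a1) (+)
   cycle_parity u (p :: a2 ++ v :: b1 ++ [:: q])) = true.
Proof.
move=> U cs uv pq.
have cs' : path (@adj _) u (rcons (a1 ++ p :: (a2 ++ v :: (b1 ++ q :: b2))) u) by [].
move: cs'; rewrite !path_mid => /and4P[e1 e2 f1 f2].
have uv' : path (@adj _) u [:: v] by rewrite /= uv.
have pq' : path (@adj _) p [:: q] by rewrite /= pq.
case: (walk_crossing_sum uv' pq') => [|? H1]; first by walk_disjoint U.
case: (walk_crossing_sum e1 f1) => [|? H2]; first by walk_disjoint U.
case: (walk_crossing_sum e2 f2) => [|? H3]; first by walk_disjoint U.
rewrite !last_rcons in H2 H3; rewrite /= in H1.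
have -> z : cycle_parity z (u :: v :: b1 ++ q :: b2) =
    m z u v (+) wp z v (rcons b1 q) (+) wp z q (rcons b2 u).
  by rewrite (cycle_parity2 z u v [::]) /= addbF walk_parity_mid addbA.
have -> z : cycle_parity z (u :: a1 ++ p :: a2 ++ [:: v]) =
    wp z u (rcons a1 p) (+) wp z p (rcons a2 v) (+) m z v u.
  by rewrite cycle_parity2 walk_parity_mid /= addbF addbA.
have -> z : cycle_parity z (p :: q :: b2 ++ u :: a1) =
    m z p q (+) wp z q (rcons b2 u) (+) wp z u (rcons a1 p).
  by rewrite (cycle_parity2 z p q [::]) /= addbF walk_parity_mid addbA.
have -> z : cycle_parity z (p :: a2 ++ v :: b1 ++ [:: q]) =
    wp z p (rcons a2 v) (+) wp z v (rcons b1 q) (+) m z q p.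
  by rewrite cycle_parity2 walk_parity_mid /= addbF addbA.
rewrite !addbF in H1; rewrite (mC _ v u) (mC _ q p).
have up : u != p by uniq_neq U p.
have pv : p != v by uniq_neq U v.
have uv0 : u != v by uniq_neq U v.
move: (order_sum up) (order_sum pv) (order_sum uv0) => ? ? ?.
xor_lia.
Qed.

(* The walks representing two edges of [K33] with a common end may meet; the
   equations of the 18 pairs of disjoint edges are already contradictory. *)
Lemma no_K33_model (f : G -> bool * 'I_3) :
  ~ model [rel x y : bool * 'I_3 | x.1 != y.1] f.
Proof.
move=> fM; have [surj _ _] := fM.
have root h : {x | f x = h}.
  by have [|x /eqP] := @sigW _ (fun x => f x == h); [case: (surj h) => x <-; exists x | exists x].
pose a i := sval (root (false, i)); pose b i := sval (root (true, i)).
have fa i : f (a i) = (false, i) := svalP (root _).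
have fb i : f (b i) = (true, i) := svalP (root _).
(* Each walk stays in the branch sets of its two ends, so walks for disjoint edges of K33 are
   disjoint. *)
have walk i j : {s | [&& path (@adj _) (a i) s, last (a i) s == b j &
    all [pred z | f z \in [:: (false, i); (true, j)]] s]}.
  apply: sigW; have := model_walk (x := a i) (y := b j) fM.
  by rewrite fa fb => /(_ isT)[s [h1 h2 h3]]; exists s; rewrite h1 h2 eqxx.
pose W i j z := wp z (a i) (sval (walk i j)).
have E i k j l' : i != k -> j != l' ->
    exists n : nat, W k l' (a i) + W k l' (b j) + W i j (a k) + W i j (b l') +
      l (a i) (a k) + l (b j) (a k) + l (a i) (b l') + l (b j) (b l') = 2 * n.
  move=> ik jl; have /and3P[p1 /eqP q1 /allP r1] := svalP (walk i j).
  have /and3P[p2 /eqP q2 /allP r2] := svalP (walk k l').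
  have := walk_crossing_sum p1 p2; rewrite q1 q2; apply=> y.
  move=> h1 h2; have : f y \in [:: (false, i); (true, j)].
    by move: h1; rewrite inE => /orP[/eqP->|/r1//]; rewrite fa inE eqxx.
  have : f y \in [:: (false, k); (true, l')].
    by move: h2; rewrite inE => /orP[/eqP->|/r2//]; rewrite fa inE eqxx.
  rewrite !inE => /orP[]/eqP-> /=; rewrite !xpair_eqE /= ?orbF.
    by rewrite eq_sym (negPf ik).
  by rewrite eq_sym (negPf jl).
have bN i j : i != j -> b i != b j.
  by apply: contra => /eqP e; have := fb i; rewrite e fb => -[->].
have abN i j : a i != b j.
  by apply/eqP => e; have := fa i; rewrite e fb.
pose o (i : nat) : 'I_3 := inord i.
have oN i k : [&& i < 3, k < 3 & i != k] -> o i != o k.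
  by case/and3P=> i3 k3; rewrite -val_eqE /= !inordK.
case: (E _ _ _ _ (oN 0 1 isT) (oN 0 1 isT)) => ? ?.
case: (E _ _ _ _ (oN 0 1 isT) (oN 0 2 isT)) => ? ?.
case: (E _ _ _ _ (oN 0 1 isT) (oN 1 0 isT)) => ? ?.
case: (E _ _ _ _ (oN 0 1 isT) (oN 1 2 isT)) => ? ?.
case: (E _ _ _ _ (oN 0 1 isT) (oN 2 0 isT)) => ? ?.
case: (E _ _ _ _ (oN 0 1 isT) (oN 2 1 isT)) => ? ?.
case: (E _ _ _ _ (oN 0 2 isT) (oN 0 1 isT)) => ? ?.
case: (E _ _ _ _ (oN 0 2 isT) (oN 0 2 isT)) => ? ?.
case: (E _ _ _ _ (oN 0 2 isT) (oN 1 0 isT)) => ? ?.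
case: (E _ _ _ _ (oN 0 2 isT) (oN 1 2 isT)) => ? ?.
case: (E _ _ _ _ (oN 0 2 isT) (oN 2 0 isT)) => ? ?.
case: (E _ _ _ _ (oN 0 2 isT) (oN 2 1 isT)) => ? ?.
case: (E _ _ _ _ (oN 1 2 isT) (oN 0 1 isT)) => ? ?.
case: (E _ _ _ _ (oN 1 2 isT) (oN 0 2 isT)) => ? ?.
case: (E _ _ _ _ (oN 1 2 isT) (oN 1 0 isT)) => ? ?.
case: (E _ _ _ _ (oN 1 2 isT) (oN 1 2 isT)) => ? ?.
case: (E _ _ _ _ (oN 1 2 isT) (oN 2 0 isT)) => ? ?.
case: (E _ _ _ _ (oN 1 2 isT) (oN 2 1 isT)) => ? ?.
have := order_sum (bN _ _ (oN 0 1 isT)) => ?.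
have := order_sum (bN _ _ (oN 0 2 isT)) => ?.
have := order_sum (bN _ _ (oN 1 2 isT)) => ?.
have := order_sum (abN (o 0) (o 0)) => ?.
have := order_sum (abN (o 0) (o 1)) => ?.
have := order_sum (abN (o 0) (o 2)) => ?.
have := order_sum (abN (o 1) (o 0)) => ?.
have := order_sum (abN (o 1) (o 1)) => ?.
have := order_sum (abN (o 1) (o 2)) => ?.
have := order_sum (abN (o 2) (o 0)) => ?.
have := order_sum (abN (o 2) (o 1)) => ?.
have := order_sum (abN (o 2) (o 2)) => ?.
suff: false = true by [].
xor_lia.
Qed.
End GraphParity.

(** * From models to minors *)

Section Minors.
Implicit Types G H : sgraph.

Lemma minor_card H G : minor H G -> #|H| <= #|G|.
Proof.
elim=> {G} [G [f [/bij_eq_card->]]|G v _ /leq_trans|G u v _ _ /leq_trans|G u v _ _ /leq_trans] //.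
- by apply; apply: leq_card val_inj.
- by apply; apply: leq_card val_inj.
Qed.

Lemma connect_homo (T T' : finType) (e : rel T) (e' : rel T') (h : T -> T') x y :
  (forall a b, e a b -> connect e' (h a) (h b)) ->
  connect e x y -> connect e' (h x) (h y).
Proof.
move=> he /connectP[p + ->]; elim: p x => //= z p IH x /andP[/he xz /IH].
exact: connect_trans.
Qed.

(** Induction on the number of edges: delete an edge whose image is not an edge of [H]. When there
    is none, [f] is an isomorphism. *)
Lemma bijective_model_minor G H (f : G -> H) :
  injective f -> model (@adj H) f -> minor H G.
Proof.
have [n] := ubnP #|[set p : G * G | adj p.1 p.2]|.
elim: n G f => // n IH G f ltn injf fM; have [surj _ edge] := fM.
have fbij : bijective f.
  apply: inj_card_bij => //.
  have [g gK] : exists g : H -> G, cancel g f.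
    exists (fun h => xchoose (P := fun x => f x == h)
      (let: ex_intro x fx := surj h in ex_intro _ x (introT eqP fx))).
    by move=> h; apply/eqP/(xchooseP (P := fun x => f x == h)).
  exact: leq_card (can_inj gK).
have [/existsP[x /existsP[y /andP[xy nxy]]]|/existsPn nex] :=
    boolP [exists x, exists y, adj x y && ~~ adj (f x) (f y)]; last first.
  apply: minor_iso; exists f; split => // x y; apply/idP/idP.
    move/edge=> [x' [y' [/injf-> /injf-> //]]].
  by move=> xy; move/existsPn/(_ y): (nex x); rewrite xy negbK.
apply: (minor_del_edge xy); apply: (IH (del_edge x y) f) => //.
  rewrite ltnS in ltn; apply: leq_trans ltn; apply: proper_card.
  apply/properP; split.
    by apply/subsetP => p; rewrite !inE => /andP[].
  by exists (x, y); rewrite !inE //= /del_edge_rel xy !eqxx.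
split=> // [a b /injf->|h h']; first exact: connect0.
move=> hh; have [a [b [fa fb ab]]] := edge _ _ hh.
exists a, b; split=> //; rewrite /= /del_edge_rel ab /=.
apply/negP => /orP[] /andP[/eqP ea /eqP eb]; move: nxy.
  by rewrite -ea -eb fa fb hh.
by rewrite adj_sym -ea -eb fa fb hh.
Qed.

(** Induction on the number of vertices: if [f] is not injective, some connected fibre contains an
    edge [uv], and contracting it preserves the model. The map [p] is the projection onto the
    contracted graph. *)
Theorem model_minor G H (f : G -> H) : model (@adj H) f -> minor H G.
Proof.
have [n] := ubnP #|G|; elim: n G f => // n IH G f ltn fM.
have [surj conn edge] := fM.
have [/injectiveP|/injectivePn[x [y xy fxy]]] := boolP (injectiveb f).
  by move=> injf; apply: bijective_model_minor fM.
have [u [v [uv fuv]]] : exists u v, adj u v /\ f u = f v.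
  have /connectP[[|z s] /=] := conn _ _ fxy; first by move=> _ e; rewrite e eqxx in xy.
  by move=> /andP[/andP[/eqP ? ?] _] _; exists x, z.
have nuv : u != v by apply/eqP => e; rewrite e adj_irrefl in uv.
pose pu : {x : G | x != v} := exist _ u nuv.
pose p w : {x : G | x != v} := insubd pu w.
have pval w : val (p w) = if w == v then u else w.
  by rewrite val_insubd; case: (w == v).
have fp w : f (val (p w)) = f w by rewrite pval; case: eqP => // ->.
have pK (a : {x : G | x != v}) : p (val a) = a by apply: val_inj; rewrite pval (negPf (valP a)).
have padj a b : adj a b -> p a != p b -> contract_rel u (p a) (p b).
  rewrite /contract_rel => ab ->; rewrite /= !pval.
  case: (altP (a =P v)) => [ea|_]; case: (altP (b =P v)) => [eb|_].
  - by rewrite ea eb adj_irrefl in ab.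
  - by move: ab; rewrite ea => ->; rewrite eqxx orbT.
  - by move: ab; rewrite eb adj_sym => ->; rewrite eqxx !orbT.
  - by rewrite ab.
apply: (minor_contract uv).
apply: (IH (contract_edge u v) (fun x => f (val x))).
  rewrite ltnS in ltn; apply: leq_trans ltn.
  rewrite card_sig; apply: proper_card; apply/properP; split.
    by apply/subsetP.
  by exists v => //; rewrite !inE eqxx.
split=> [h|a b fab|h h' hh].
- by have [z fz] := surj h; exists (p z); apply: etrans (fp z) fz.
- rewrite -[a]pK -[b]pK; apply: connect_homo (conn _ _ fab) => c d.
  move=> /andP[/eqP fcd cd]; have [->//|ncd] := eqVneq (p c) (p d).
  apply: connect1; apply/andP; split; last exact: padj.
  by apply/eqP; apply: etrans (fp c) _; rewrite fcd -(fp d).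
- have [a [b [fa fb ab]]] := edge _ _ hh; exists (p a), (p b).
  split; [exact: etrans (fp a) fa|exact: etrans (fp b) fb|apply: padj => //].
  by apply/eqP => e; move: hh; rewrite -fa -fb -(fp a) -(fp b) e adj_irrefl.
Qed.
End Minors.

(** * Rounding an octahedron model *)

Section ConnectedSets.
Variable G : sgraph.
Implicit Types (x y z : G) (A B D V : {set G}).

Definition rel_in A : rel G := [rel u v | [&& u \in A, v \in A & adj u v]].
Definition conn A := {in A &, forall x y, connect (rel_in A) x y}.
Definition component A x := [set y | connect (rel_in A) x y].

Lemma rel_inE A x y : rel_in A x y = [&& x \in A, y \in A & adj x y].
Proof. by []. Qed.

Lemma rel_in_sym A : symmetric (rel_in A).
Proof. by move=> x y; rewrite /rel_in /= adj_sym andbCA. Qed.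

Lemma connect_in_sym A : connect_sym (rel_in A).
Proof. exact: sym_connect_sym (rel_in_sym A). Qed.

Lemma connect_inS A B x y : A \subset B ->
  connect (rel_in A) x y -> connect (rel_in B) x y.
Proof.
move=> /subsetP AB; apply: connect_sub => u v /and3P[uA vA uv].
by apply: connect1; rewrite rel_inE uv !AB.
Qed.

Lemma conn1 x : conn [set x].
Proof. by move=> a b /set1P-> /set1P->; apply: connect0. Qed.

Lemma conn_star A x : x \in A -> (forall y, y \in A -> connect (rel_in A) x y) ->
  conn A.
Proof.
move=> xA h a b aA bA; apply: connect_trans (h b bA).
by rewrite connect_in_sym; apply: h.
Qed.

Lemma connU A B x y : conn A -> conn B -> x \in A -> y \in B -> adj x y ->
  conn (A :|: B).
Proof.
move=> cA cB xA yB xy; apply: (@conn_star _ x); first by rewrite inE xA.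
move=> z; rewrite inE => /orP[zA|zB].
  by apply: connect_inS (cA _ _ xA zA); apply: subsetUl.
apply: connect_trans (connect_inS (subsetUr A B) (cB _ _ yB zB)).
by apply: connect1; rewrite rel_inE !inE xA yB orbT.
Qed.

Lemma mem_comp A x : x \in component A x.
Proof. by rewrite inE connect0. Qed.

Lemma comp_sub A x : x \in A -> component A x \subset A.
Proof.
move=> xA; apply/subsetP => y; rewrite inE => /connectP[p + ->].
by elim: p x xA => //= z p IH x xA /andP[/and3P[_ zA _] /IH]; apply.
Qed.

Lemma comp_closed A x y z : y \in A -> z \in A -> adj y z ->
  (y \in component A x) = (z \in component A x).
Proof.
move=> yA zA yz; rewrite !inE !(connect_in_sym _ x).
apply: (same_connect (connect_in_sym A)); apply: connect1.
by rewrite rel_inE yA zA.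
Qed.

Lemma comp_conn A x : x \in A -> conn (component A x).
Proof.
move=> xA; apply: (@conn_star _ x); first exact: mem_comp.
move=> y; rewrite inE => /connectP[p + ->] {y}.
have: x \in component A x by apply: mem_comp.
elim/last_ind: p => [|p z IH] h; first by rewrite connect0.
rewrite rcons_path last_rcons => /andP[/[dup] px /(IH h) cp].
move=> /and3P[lA zA lz]; apply: connect_trans cp _; apply: connect1.
have ll : last x p \in component A x by rewrite inE; apply/connectP; exists p.
by rewrite rel_inE lz andbT ll -(comp_closed x lA zA lz).
Qed.

Lemma comp_eq A x y : y \in component A x -> component A y = component A x.
Proof.
rewrite inE => xy; apply/setP => z; rewrite !inE.
by rewrite (same_connect (connect_in_sym A) xy).
Qed.

Lemma conn_edge V B x y : conn V -> x \in V -> x \in B -> y \in V -> y \notin B ->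
  exists u v, [/\ u \in V :&: B, v \in V :\: B & adj u v].
Proof.
move=> cV xV xB yV; have /connectP[p + ->] := cV x y xV yV.
elim: p x xV xB => [|z p IH] x xV xB /=; first by rewrite xB.
case/andP=> /and3P[_ zV xz] pz; case zB : (z \in B); first exact: IH.
by move=> _; exists x, z; rewrite !inE xB xV zB zV.
Qed.

(** Within [V], the only neighbour of the component outside it is [x]. So a walk in [V] from a
    vertex outside the component to [x] cannot enter the component before it has reached [x]. *)
Lemma conn_comp_compl V x y : conn V -> x \in V -> y \in V -> y != x ->
  conn (V :\: component (V :\ x) y).
Proof.
move=> cV xV yV yx; set D := component _ _.
have yV' : y \in V :\ x by rewrite !inE yx.
have DV : D \subset V :\ x := comp_sub yV'.
have xD : x \in V :\: D.
  rewrite inE xV andbT; apply/negP => /(subsetP DV).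
  by rewrite !inE eqxx.
apply: (conn_star xD) => z zVD; rewrite connect_in_sym.
have [|xn] := boolP (x \in component (V :\: D) z); first by rewrite inE.
have zV : z \in V by move: zVD; rewrite inE => /andP[].
have [u [v [/setIP[uV uC] /setDP[vV vC] uv]]] := conn_edge cV zV (mem_comp _ z) xV xn.
have uVD := subsetP (comp_sub zVD) _ uC.
have vD : v \in D.
  apply/negPn/negP => nvD; have vVD : v \in V :\: D by rewrite inE nvD.
  by move: vC; rewrite -(comp_closed z uVD vVD uv) uC.
have ux : u != x by apply: contraNneq xn => <-.
have uV' : u \in V :\ x by rewrite !inE ux.
have /setDP[_ /negP[]] := uVD.
by rewrite /D (comp_closed y uV' (subsetP DV _ vD) uv).
Qed.
End ConnectedSets.

Section Center.
Variables (G : sgraph) (L : finType) (seen : {set G} -> {set L}) (V : {set G}).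
Hypothesis seen0 : seen set0 = set0.
Hypothesis seenU : forall A B : {set G}, seen (A :|: B) = seen A :|: seen B.
Hypothesis connV : conn V.
Hypothesis bigV : 3 < #|seen V|.
Hypothesis splits : forall B : {set G}, B \subset V -> B != set0 -> V :\: B != set0 ->
  conn B -> conn (V :\: B) -> #|seen B| <= 1 \/ #|seen (V :\: B)| <= 1.

Lemma seen_sub (A B : {set G}) : A \subset B -> seen A \subset seen B.
Proof. by move/setUidPr <-; rewrite seenU subsetUl. Qed.

(* Take [B] minimal among the connected sets with connected complement [A] and
   more than one label. If [x], [x2] in [B] were both adjacent to [A], the
   component of [x2] in [B - x] and that of [x] in [B - x2] would cover [B], so
   that [V] would see at most three labels. Hence the vertex of [B] adjacent to
   [A] is unique, and it is the required centre. *)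
Lemma center_exists :
  exists2 x, x \in V & forall y, y \in V -> y != x -> #|seen (component (V :\ x) y)| <= 1.
Proof.
pose P (B : {set G}) := [&& B \subset V, 1 < #|seen B|,
  [forall x in B, forall y in B, connect (rel_in B) x y] &
  [forall x in V :\: B, forall y in V :\: B, connect (rel_in (V :\: B)) x y]].
have connP (B : {set G}) : reflect (conn B)
    [forall x in B, forall y in B, connect (rel_in B) x y].
  apply: (iffP forall_inP) => [h x y xB yB|h x xB]; first exact: (forall_inP (h x xB)).
  by apply/forall_inP => y yB; apply: h.
have PV : P V.
  apply/and4P; split=> //; first exact: ltn_trans bigV.
    exact: (introT (connP V) connV).
  by apply: (introT (connP _)); rewrite setDv => x y; rewrite inE.
have [B /and4P[BV bigB /connP cB /connP cA] minB] := @arg_minnP _ V P (fun B : {set G} => #|B|) PV.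
have small (D : {set G}) : D \proper B -> conn D -> conn (V :\: D) -> #|seen D| <= 1.
  move=> DB cD cVD; rewrite leqNgt; apply/negP => bigD.
  have : P D.
    apply/and4P; split=> //; first exact: subset_trans (proper_sub DB) BV.
      exact: (introT (connP _) cD).
    exact: (introT (connP _) cVD).
  by move/minB; rewrite leqNgt proper_card.
set A := V :\: B in cA.
have [A0|[z zA]] := set_0Vmem A.
  (* With nothing outside [B], any vertex [x] is a centre: each component of [V - x] is a proper
     connected subset with connected complement, so minimality of [B] bounds its labels. *)
  have eBV : B = V.
    by apply/eqP; rewrite eqEsubset BV -setD_eq0 -/A A0 eqxx.
  rewrite eBV in small bigB.
  have [x xV] : exists x, x \in V.
    apply/set0Pn; apply: contraTneq bigB => ->.
    by rewrite seen0 cards0.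
  exists x => // y yV yx; apply: small.
  - have yV' : y \in V :\ x by rewrite !inE yx.
    apply: sub_proper_trans (comp_sub yV') _.
    by apply/properP; split; [exact: subD1set|exists x; rewrite // !inE eqxx].
  - by apply: comp_conn; rewrite !inE yx.
  - exact: conn_comp_compl.
have [b bB] : exists b, b \in B.
  by apply/set0Pn; apply: contraTneq bigB => ->; rewrite seen0 cards0.
have AV : A \subset V := subsetDl _ _.
have zB : z \notin B by move: zA; rewrite inE => /andP[].
have [x [w [/setIP[xV xB] /setDP[wV wB] xw]]] :=
  conn_edge connV (subsetP BV _ bB) bB (subsetP AV _ zA) zB.
have wA : w \in A by rewrite inE wB.
have seenA : #|seen A| <= 1.
  have [] := splits BV _ _ cB cA => //.
  - by apply/set0Pn; exists b.
  - by apply/set0Pn; exists z.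
  - by rewrite leqNgt bigB.
have smallD x0 w0 y : x0 \in B -> w0 \in A -> adj x0 w0 -> y \in B -> y != x0 ->
    #|seen (component (B :\ x0) y)| <= 1.
  move=> x0B w0A xw0 yB yx; have yB' : y \in B :\ x0 by rewrite !inE yx.
  have sB : component (B :\ x0) y \subset B :\ x0 := comp_sub yB'.
  apply: small.
  - apply: sub_proper_trans sB _.
    by apply/properP; split; [exact: subD1set|exists x0; rewrite // !inE eqxx].
  - exact: comp_conn.
  - have -> : V :\: component (B :\ x0) y = (B :\: component (B :\ x0) y) :|: A.
      apply/setP => u; rewrite /A in_setU !in_setD.
      have h1 : u \in component (B :\ x0) y -> u \in B.
        by move/(subsetP sB); rewrite !inE => /andP[].
      have h2 := subsetP BV u; move: h1 h2.
      case: (u \in component _ _); case: (u \in B); case: (u \in V) => h1 h2 //;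
        by [move: (h1 isT) | move: (h2 isT)].
    apply: connU xw0 => //; first exact: conn_comp_compl.
    rewrite inE x0B andbT; apply/negP => /(subsetP sB).
    by rewrite !inE eqxx.
have uniqx y w' : y \in B -> w' \in A -> adj y w' -> y = x.
  move=> yB w'A yw'; apply/eqP/negPn/negP => yx.
  have xy : x != y by rewrite eq_sym.
  have yB' : y \in B :\ x by rewrite !inE yx.
  have xB' : x \in B :\ y by rewrite !inE xy.
  have s1 := smallD x w y xB wA xw yB yx.
  have s2 := smallD y w' x yB w'A yw' xB xy.
  have eV : V = A :|: (component (B :\ x) y :|: component (B :\ y) x).
    apply/setP => u; rewrite in_setU in_setU in_setD.
    have [uB|uB] := boolP (u \in B) => /=; last first.
      have -> : u \in component (B :\ x) y = false.
        by apply/negP => /(subsetP (comp_sub yB')); rewrite !inE (negPf uB) andbF.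
      have -> : u \in component (B :\ y) x = false.
        by apply/negP => /(subsetP (comp_sub xB')); rewrite !inE (negPf uB) andbF.
      by rewrite !orbF.
    rewrite (subsetP BV _ uB); apply/esym.
    have [//|nu1] := boolP (u \in component (B :\ x) y); rewrite /=.
    have [->|ux] := eqVneq u x; first exact: mem_comp.
    have uB' : u \in B :\ x by rewrite !inE ux.
    set C := component (B :\ x) u.
    have CB : C \subset B :\ x := comp_sub uB'.
    have yC : y \notin C.
      by apply: contra nu1 => /comp_eq->; apply: mem_comp.
    have xC : x \notin C by apply/negP => /(subsetP CB); rewrite !inE eqxx.
    have [u1 [v1 [/setIP[u1B u1C] /setDP[v1B v1C] uv1]]] :=
      conn_edge cB uB (mem_comp _ u : u \in C) xB xC.
    have v1x : v1 = x.
      apply/eqP/negPn/negP => v1x; move: v1C.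
      have v1B' : v1 \in B :\ x by rewrite !inE v1x.
      by rewrite -(comp_closed u (subsetP CB _ u1C) v1B' uv1) u1C.
    have CBy : C \subset B :\ y.
      apply/subsetP => c cC; have := subsetP CB _ cC; rewrite !inE => /andP[_ ->].
      by rewrite andbT; apply: contraNneq yC => <-.
    rewrite inE connect_in_sym.
    apply: connect_trans (connect_inS CBy (comp_conn uB' (mem_comp _ u) u1C)) _.
    by apply: connect1; rewrite rel_inE (subsetP CBy) // xB' -v1x uv1.
  have := bigV; rewrite eV !seenU ltnNge => /negP; apply.
  apply: leq_trans (leq_card_setU _ _) _; apply: (@leq_add _ _ 1 2) => //.
  by apply: leq_trans (leq_card_setU _ _) _; apply: (leq_add s1 s2).
exists x => // y yV yx.
have yV' : y \in V :\ x by rewrite !inE yx.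
set D := component (V :\ x) y.
have DV : D \subset V :\ x := comp_sub yV'.
have cD : conn D := comp_conn yV'.
(* Since [x] is the only vertex of [B] adjacent to [A], a component of [V - x] lies entirely in
   [B - x] or entirely in [A]. *)
have [yB|yB] := boolP (y \in B).
  have DB : D \subset B :\ x.
    apply/subsetP => u uD; have := subsetP DV _ uD; rewrite !inE => /andP[-> uV] /=.
    apply/negPn/negP => uB.
    have [p [q [/setIP[pD pB] /setDP[qD qB] pq]]] := conn_edge cD (mem_comp _ y) yB uD uB.
    have qA : q \in A.
      by rewrite inE qB; have := subsetP DV _ qD; rewrite !inE => /andP[].
    by have := subsetP DV _ pD; rewrite !inE (uniqx _ _ pB qA pq) eqxx.
  apply: leq_trans (smallD x w y xB wA xw yB yx).
  apply/subset_leq_card/seen_sub/subsetP => u uD; rewrite inE.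
  exact: connect_inS DB (cD _ _ (mem_comp _ y) uD).
have yA : y \in A by rewrite inE yB.
have DA : D \subset A.
  apply/subsetP => u uD; apply/negPn/negP => uA.
  have [p [q [/setIP[pD pA] /setDP[qD qA] pq]]] := conn_edge cD (mem_comp _ y) yA uD uA.
  have qx : q \in V :\ x := subsetP DV _ qD.
  have qB : q \in B.
    by move: qA qx; rewrite !inE; case: (q \in B) => //= h /andP[_ qV]; rewrite qV in h.
  have qx' : q = x by apply: uniqx qB pA _; rewrite adj_sym.
  by move: qx; rewrite qx' !inE eqxx.
exact: leq_trans (subset_leq_card (seen_sub DA)) seenA.
Qed.
End Center.

(** * Merging branch sets *)

Section Coarsening.
Variables (G : sgraph) (L : eqType) (g : G -> L).

Definition touch : rel L := fun h h' =>
  [exists x, exists y, [&& g x == h, g y == h' & adj x y]].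

Lemma touchP h h' : reflect (exists x y, [/\ g x = h, g y = h' & adj x y]) (touch h h').
Proof.
apply: (iffP existsP) => [[x /existsP[y /and3P[/eqP? /eqP? ?]]]|[x [y [? ? ?]]]].
  by exists x, y.
by exists x; apply/existsP; exists y; apply/and3P; split=> //; apply/eqP.
Qed.

Lemma touch_sym : symmetric touch.
Proof.
by move=> h h'; apply/touchP/touchP => -[x [y [? ? ?]]]; exists y, x; rewrite adj_sym.
Qed.

Lemma model_touch e : model e g -> forall h h', e h h' -> touch h h'.
Proof. by case=> _ _ E h h' /E ?; apply/touchP. Qed.

(** Labels identified by [phi] must touch, so that merged branch sets stay connected. The section
    [psi] picks in each class the label that witnesses the edges of the smaller pattern; the others
    in the class are merely absorbed. *)
Lemma coarsen_model (L' : eqType) (e' : rel L') (phi : L -> L') (psi : L' -> L) :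
  (forall h, exists x, g x = h) ->
  (forall x y, g x = g y -> connect (fiber_rel g) x y) ->
  cancel psi phi ->
  (forall h1 h2, phi h1 = phi h2 -> h1 = h2 \/ touch h1 h2) ->
  (forall h h', e' h h' -> touch (psi h) (psi h')) ->
  model e' (fun x => phi (g x)).
Proof.
move=> surj conng psiK phiI E; split.
- by move=> h; have [x gx] := surj (psi h); exists x; rewrite gx psiK.
- have sub x y : connect (fiber_rel g) x y ->
      connect (fiber_rel (fun x => phi (g x))) x y.
    apply: connect_sub => u v /andP[/eqP guv uv]; apply: connect1.
    by apply/andP; split=> //; rewrite guv.
  move=> x y /[dup] pxy /phiI[gxy|/touchP[u [v [gu gv uv]]]]; first exact/sub/conng.
  apply: connect_trans (sub _ _ (conng x u (esym gu))) _.
  apply: connect_trans (sub _ _ (conng v y gv)); apply: connect1.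
  by apply/andP; split; rewrite //= gu gv pxy.
- move=> h h' /E /touchP[x [y [gx gy xy]]]; exists x, y.
  by rewrite gx gy !psiK.
Qed.

Lemma fiber_connP : (forall x y, g x = g y -> connect (fiber_rel g) x y) <->
  (forall h, conn [set x | g x == h]).
Proof.
split=> [h l x y|h x y gxy].
  rewrite !inE => /eqP gx /eqP gy.
  have /h/connectP[p + ->] : g x = g y by rewrite gx gy.
  elim: p x gx {gy} => //= z p IH x gx /andP[/andP[/eqP gxz xz] pz].
  apply: connect_trans (IH z _ pz); last by rewrite -gxz.
  by apply: connect1; rewrite rel_inE !inE -gxz gx eqxx xz.
have := h (g y) x y; rewrite !inE gxy eqxx => /(_ isT isT).
apply: connect_sub => u v; rewrite rel_inE !inE => /and3P[/eqP gu /eqP gv uv].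
by apply: connect1; rewrite /fiber_rel /= gu gv eqxx.
Qed.
End Coarsening.

(** The index [option bool] is chosen with the octahedron in mind: in the uses below [Some false]
    and [Some true] come from an antipodal pair, and [None] is the third vertex of the side. *)
Definition K33_rel : rel (bool * option bool) := [rel x y | x.1 != y.1].

Lemma no_K33_model_of (G : sgraph) :
  (forall f : G -> bool * 'I_3, ~ model [rel x y : bool * 'I_3 | x.1 != y.1] f) ->
  forall f : G -> bool * option bool, ~ model K33_rel f.
Proof.
move=> no f [surj cf E].
pose phi (x : bool * option bool) : bool * 'I_3 :=
  (x.1, if x.2 is Some b then inord b else inord 2).
pose psi (x : bool * 'I_3) : bool * option bool :=
  (x.1, if x.2 < 2 then Some (x.2 == 1 :> nat) else None).
apply: (no (fun x => phi (f x))); apply: (@coarsen_model _ _ _ _ _ phi psi) => //.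
- case=> s [i i3]; rewrite /phi /psi /=; congr pair; apply: val_inj.
  by case: i i3 => [|[|[|]]] //= _; rewrite inordK.
- move=> [s1 i1] [s2 i2] [-> eq]; left; congr pair.
  have := congr1 (@nat_of_ord 3) eq.
  by case: i1 i2 {eq} => [[]|] [[]|] //=; rewrite !inordK.
- by move=> h h' /= hh; apply/touchP; apply: E.
Qed.

Lemma other_axes (i : 'I_3) : exists j k : 'I_3,
  [/\ j != i, k != i, j != k & forall t, [|| t == i, t == j | t == k]].
Proof.
exists (inord (i.+1 %% 3)), (inord (i.+2 %% 3)).
by case: i => [[|[|[|]]] i3] //; split=> [|||t]; rewrite -!val_eqE /= ?inordK //;
  case: t => [[|[|[|]]]].
Qed.

Lemma ord3P (i : 'I_3) : [\/ i = inord 0, i = inord 1 | i = inord 2].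
Proof.
case: i => [[|[|[|]]] i3] //; [constructor 1|constructor 2|constructor 3];
  by apply: val_inj; rewrite /= inordK.
Qed.

(** * Forbidden configurations in an octahedron model *)

Section OctModel.
Variables (G : sgraph) (f : G -> Oct).
Hypothesis fM : model (@adj Oct) f.
Hypothesis noK33 : forall h : G -> bool * option bool, ~ model K33_rel h.
Hypothesis noOct1p : forall h : G -> Oct1p, ~ model (@adj Oct1p) h.
Implicit Types (o p : Oct) (A B D : {set G}).

Definition antipode o : Oct := (o.1, ~~ o.2).
Definition branch o := [set x | f x == o].
Definition sees A p := [exists x in A, exists y, (f y == p) && adj x y].

Lemma antipode_eq o p : p.1 = o.1 -> p != o -> p = antipode o.
Proof.
case: o p => [c d] [a b] /= ->; rewrite /antipode /=.
by case: b d => [] []; rewrite ?eqxx.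
Qed.

Lemma antipode_neq o : antipode o != o.
Proof. by apply/eqP => /(congr1 snd) /=; case: (o.2). Qed.

Lemma seesP A p : reflect (exists x y, [/\ x \in A, f y = p & adj x y]) (sees A p).
Proof.
apply: (iffP exists_inP) => [[x xA /existsP[y /andP[/eqP fy xy]]]|[x [y [xA fy xy]]]].
  by exists x, y.
by exists x => //; apply/existsP; exists y; rewrite fy eqxx.
Qed.

Lemma branch_conn o : conn (branch o).
Proof. by case: fM => _ /fiber_connP h _; apply: h. Qed.

Lemma touch_oct o p : o.1 != p.1 -> touch f o p.
Proof. exact: (model_touch fM). Qed.

(** An edge between antipodal branch sets completes a K33: one side is [o] with the two labels of
    axis [j], the other is [antipode o] with the two labels of axis [k]. *)
Lemma opposite_nonadjacent x y : f y = antipode (f x) -> ~~ adj x y.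
Proof.
move=> fy; apply/negP => xy; set o := f x in fy.
have [j [k [jo ko jk cov]]] := other_axes o.1.
pose phi (z : Oct) := if z.1 == o.1 then (z != o, None) else (z.1 == k, Some z.2).
pose psi (h : bool * option bool) : Oct :=
  if h.2 is Some b then (if h.1 then k else j, b) else if h.1 then antipode o else o.
have phiK : cancel phi psi.
  case=> a b; rewrite /phi /psi /=; case: ifPn => /= [/eqP->|ao].
    rewrite /antipode; case: (o) => c d /=; rewrite xpair_eqE eqxx /=.
    by case: b d => [] [].
  by case: ifPn => [/eqP->//|ak]; have := cov a; rewrite (negPf ao) (negPf ak) orbF => /eqP->.
have psiK : cancel psi phi.
  case=> s [b|]; rewrite /phi /psi /=; case: s => /=.
  - by rewrite (negPf ko) eqxx.
  - by rewrite (negPf jo) (negPf jk).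
  - by rewrite eqxx /antipode; case: (o) => c [] /=; rewrite xpair_eqE eqxx.
  - by rewrite !eqxx.
case: fM => surj cf _.
apply: (noK33 (h := fun x => phi (f x))); apply: (coarsen_model (psi := psi)) => //.
  by move=> h1 h2 /(can_inj phiK); left.
have oo : touch f o (antipode o) by apply/touchP; exists x, y.
have key i1 i2 : touch f (psi (false, i1)) (psi (true, i2)).
  case: i1 i2 => [b1|] [b2|]; rewrite /psi /=; last exact: oo.
  - by apply: touch_oct; apply: jk.
  - by apply: touch_oct; apply: jo.
  - by apply: touch_oct; rewrite eq_sym; apply: ko.
move=> [s1 i1] [s2 i2]; rewrite /K33_rel /=.
by case: s1; case: s2 => //= _; rewrite touch_sym; apply: key.
Qed.

Section Split.
Variables (o : Oct) (B : {set G}).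
Hypotheses (Bo : B \subset branch o) (B0 : B != set0) (C0 : branch o :\: B != set0).
Hypotheses (cB : conn B) (cC : conn (branch o :\: B)).
Notation C := (branch o :\: B).
(** The split-off part [B] gets the new label [None], and [Some o] now stands for the rest of the
    branch set. *)
Let g x : option Oct := if x \in B then None else Some (f x).

Lemma split_surj h : exists x, g x = h.
Proof.
case: h => [p|]; last first.
  by have /set0Pn[x xB] := B0; exists x; rewrite /g xB.
have [->|po] := eqVneq p o.
  have /set0Pn[x /setDP[xo xB]] := C0; exists x; rewrite /g (negPf xB).
  by move: xo; rewrite inE => /eqP->.
have [x fx] : exists x, f x = p by case: fM => surj _ _; apply: surj.
exists x; rewrite /g; case: ifPn => [/(subsetP Bo)|_]; last by rewrite fx.
by rewrite inE fx (negPf po).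
Qed.

Lemma split_conn x y : g x = g y -> connect (fiber_rel g) x y.
Proof.
apply/fiber_connP: x y => -[p|].
  have [->|po] := eqVneq p o.
    suff -> : [set x | g x == Some o] = C by [].
    by apply/setP => x; rewrite !inE /g; case: (x \in B).
  suff -> : [set x | g x == Some p] = branch p by apply: branch_conn.
  apply/setP => x; rewrite !inE /g; case: ifPn => // /(subsetP Bo).
  by rewrite inE => /eqP->; rewrite (eq_sym o p) (negPf po).
suff -> : [set x | g x == None] = B by [].
by apply/setP => x; rewrite !inE /g; case: (x \in B).
Qed.

Lemma split_outside x : f x != o -> g x = Some (f x).
Proof.
by rewrite /g; case: ifPn => // /(subsetP Bo); rewrite inE => ->.
Qed.

Lemma split_touch p q : p != o -> q != o -> p.1 != q.1 -> touch g (Some p) (Some q).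
Proof.
move=> po qo /touch_oct/touchP[x [y [fx fy xy]]]; apply/touchP; exists x, y.
by rewrite !split_outside ?fx ?fy.
Qed.

Lemma split_touch_None p : p != o -> sees B p -> touch g None (Some p).
Proof.
move=> po /seesP[x [y [xB fy xy]]]; apply/touchP; exists x, y.
by rewrite (@split_outside y) ?fy // /g xB.
Qed.

Lemma split_touch_Some p : p != o -> sees C p -> touch g (Some o) (Some p).
Proof.
move=> po /seesP[x [y [/setDP[xo xB] fy xy]]]; apply/touchP; exists x, y.
rewrite (@split_outside y) ?fy // /g (negPf xB); split=> //.
by move: xo; rewrite inE => /eqP->.
Qed.

Lemma split_touch_split : touch g None (Some o).
Proof.
have /set0Pn[x xB] := B0; have /set0Pn[y /setDP[yo yB]] := C0.
have [u [v [/setIP[_ uB] /setDP[vo vB] uv]]] :=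
  conn_edge (@branch_conn o) (subsetP Bo _ xB) xB yo yB.
apply/touchP; exists u, v; rewrite /g uB (negPf vB); split=> //.
by move: vo; rewrite inE => /eqP->.
Qed.

(** The K33 has sides [C], [(j, false)], [(j, true)] and [B], [(k, false)], [(k, true)], where the
    edge between [B] and [C] comes from connectivity of the old branch set. The antipode of [o] is
    absorbed into [(j, false)] so that the model still covers [G]. *)
Lemma no_crossing_split j k : j != o.1 -> k != o.1 -> j != k ->
  (forall t, [|| t == o.1, t == j | t == k]) ->
  (forall b, sees B (j, b)) -> (forall b, sees C (k, b)) -> False.
Proof.
move=> jo ko jk cov Bj Ck.
have neq (p : Oct) : p.1 != o.1 -> p != o by apply: contra => /eqP->.
pose phi (h : option Oct) : bool * option bool :=
  if h is Some z then
    if z == o then (false, None)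
    else if z.1 == o.1 then (false, Some false) else (z.1 == k, Some z.2)
  else (true, None).
pose psi (h : bool * option bool) : option Oct :=
  if h.2 is Some b then Some (if h.1 then k else j, b)
  else if h.1 then None else Some o.
apply: (noK33 (h := fun x => phi (g x))); apply: (coarsen_model (psi := psi)).
- exact: split_surj.
- exact: split_conn.
- case=> [[] [b|]]; rewrite /phi /psi //= ?eqxx //.
    by rewrite (negPf (neq _ _)) //= (negPf ko).
  by rewrite (negPf (neq _ _)) //= (negPf jo) (negPf jk).
- have key (z1 z2 : Oct) : z1.1 = o.1 -> z1 != o -> z2.1 != o.1 ->
      touch g (Some z1) (Some z2).
    by move=> e1 n1 n2; apply: split_touch => //; [exact: neq | rewrite e1 eq_sym].
  move=> [z1|] [z2|] //=; rewrite /phi; last by left.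
  + have [->|n1] := eqVneq z1 o; have [->|n2] := eqVneq z2 o; first by left.
    * by case: ifP.
    * by case: ifP.
    case: ifPn => [/eqP e1|m1]; case: ifPn => [/eqP e2|m2].
    * by left; rewrite (antipode_eq e1 n1) (antipode_eq e2 n2).
    * by right; apply: key.
    * by right; rewrite touch_sym; apply: key.
    case: (z1) (z2) m1 m2 => [a b] [c d] /= ao co [] e ->; left.
    have axis t : t != o.1 -> t = if t == k then k else j.
      move=> /negPf to; have := cov t; rewrite to /=.
      by case: (t =P k) => // _; rewrite orbF => /eqP.
    by congr (Some (_, _)); rewrite (axis a ao) (axis c co) e.
  + by case: eqP => //; case: ifP.
  + by case: eqP => //; case: ifP.
- have key i1 i2 : touch g (psi (false, i1)) (psi (true, i2)).
    case: i1 i2 => [b1|] [b2|]; rewrite /psi /=.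
    + by apply: split_touch; [exact: neq|exact: neq|exact: jk].
    + by rewrite touch_sym; apply: split_touch_None; [exact: neq|exact: Bj].
    + by apply: split_touch_Some; [exact: neq|exact: Ck].
    + by rewrite touch_sym; exact: split_touch_split.
  move=> [s1 i1] [s2 i2]; rewrite /K33_rel /=.
  by case: s1; case: s2 => //= _; rewrite touch_sym; apply: key.
Qed.

(** The two parts see complementary pairs of consecutive vertices of the 4-cycle around [o], which
    is the definition of [Oct1p] with [B] as v' and [C] as v''. The automorphism [sigma] of [Oct],
    with inverse [tau], moves [o], [(j, x)], [(k, y)] to [oct_v], [oct_a], [oct_b]. *)
Lemma no_noncrossing_split j k x y : j != o.1 -> k != o.1 -> j != k ->
  (forall t, [|| t == o.1, t == j | t == k]) ->
  sees B (j, x) -> sees B (k, y) -> sees C (j, ~~ x) -> sees C (k, ~~ y) -> False.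
Proof.
move=> jo ko jk cov Bj Bk Cj Ck.
have neq (p : Oct) : p.1 != o.1 -> p != o by apply: contra => /eqP->.
have i10 : inord 1 != inord 0 :> 'I_3 by rewrite -val_eqE /= !inordK.
have i20 : inord 2 != inord 0 :> 'I_3 by rewrite -val_eqE /= !inordK.
have i21 : inord 2 != inord 1 :> 'I_3 by rewrite -val_eqE /= !inordK.
pose sigma (z : Oct) : Oct := if z.1 == o.1 then (inord 0, z.2 (+) o.2)
  else if z.1 == j then (inord 1, z.2 (+) x) else (inord 2, z.2 (+) y).
pose tau (z : Oct) : Oct := if z.1 == inord 0 then (o.1, z.2 (+) o.2)
  else if z.1 == inord 1 then (j, z.2 (+) x) else (k, z.2 (+) y).
have sigmaK : cancel sigma tau.
  case=> a b; rewrite /sigma /tau /=.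
  have [->|ao] := eqVneq a o.1; first by rewrite /= eqxx addbK.
  have [->|aj] := eqVneq a j; first by rewrite /= (negPf i10) eqxx addbK.
  rewrite /= (negPf i20) (negPf i21) addbK; congr pair; apply/esym/eqP.
  by have := cov a; rewrite (negPf ao) (negPf aj).
have tauK : cancel tau sigma.
  case=> a b; rewrite /sigma /tau /=; case: (ord3P a) => ->.
  - by rewrite eqxx /= eqxx addbK.
  - by rewrite (negPf i10) eqxx /= (negPf jo) eqxx addbK.
  - by rewrite (negPf i20) (negPf i21) /= (negPf ko) eq_sym (negPf jk) addbK.
have tau_v : tau oct_v = o.
  by rewrite /tau /oct_v /= eqxx; case: (o).
have tau_a : tau oct_a = (j, x) by rewrite /tau /= (negPf i10) eqxx.
have tau_c : tau oct_c = (j, ~~ x) by rewrite /tau /= (negPf i10) eqxx.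
have tau_b : tau oct_b = (k, y) by rewrite /tau /= (negPf i20) (negPf i21).
have tau_d : tau oct_d = (k, ~~ y) by rewrite /tau /= (negPf i20) (negPf i21).
pose phi (h : option Oct) : Oct1p :=
  if h is Some z then
    if insub (sigma z) is Some u then inl u else inr true
  else inr false.
pose psi (h : Oct1p) : option Oct :=
  match h with
  | inl u => Some (tau (val u))
  | inr i => if i then Some o else None
  end.
have psiK : cancel psi phi.
  case=> [u|[]] //=; rewrite /phi /=; first by rewrite tauK valK.
  by rewrite -tau_v tauK insubN // negbK.
have phiK : cancel phi psi.
  case=> [z|] //=; rewrite /phi; case: insubP => [u _ uz|].
    by rewrite /psi /= uz sigmaK.
  by rewrite negbK => /eqP e; rewrite /psi -tau_v -e sigmaK.
apply: (noOct1p (h := fun x => phi (g x))); apply: (coarsen_model (psi := psi)).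
- exact: split_surj.
- exact: split_conn.
- exact: psiK.
- by move=> h1 h2 /(can_inj phiK); left.
have tau_neq (u : {x : Oct | x != oct_v}) : tau (val u) != o.
  by rewrite -tau_v (inj_eq (can_inj tauK)); apply: valP u.
have joined i (u : {x : Oct | x != oct_v}) : oct1p_joined i (val u) ->
    touch g (psi (inl u)) (psi (inr i)).
  rewrite touch_sym /oct1p_joined /psi.
  case: i; rewrite !inE => /orP[] /eqP->; rewrite ?tau_a ?tau_b ?tau_c ?tau_d.
  - by apply: split_touch_Some Cj; apply: neq.
  - by apply: split_touch_Some Ck; apply: neq.
  - by apply: split_touch_None Bj; apply: neq.
  - by apply: split_touch_None Bk; apply: neq.
case=> [u|i] [u'|i'].
- move=> uu; have {uu} : oct_rel (val u) (val u') := uu.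
  rewrite /oct_rel => uu.
  have e : (tau (val u)).1 != (tau (val u')).1.
    apply: contra uu => /eqP e.
    have : (sigma (tau (val u))).1 = (sigma (tau (val u'))).1.
      by rewrite /sigma e; case: ifP => //; case: ifP.
    by rewrite !tauK => ->.
  exact: split_touch (tau_neq u) (tau_neq u') e.
- by move=> h; have {}h : oct1p_joined i' (val u) := h; apply: (joined i' u h).
- move=> h; have {}h : oct1p_joined i (val u') := h; rewrite touch_sym.
  exact: (joined i u' h).
- case: i i' => [] [] // _; last exact: split_touch_split.
  by rewrite touch_sym; exact: split_touch_split.
Qed.
End Split.
End OctModel.

Lemma connect_exit (T : finType) (e : rel T) (A : {pred T}) x y :
  connect e x y -> x \in A -> y \notin A ->
  exists u v, [/\ u \in A, v \notin A & e u v].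
Proof.
case/connectP=> p + ->; elim: p x => [|z p IH] x /=; first by move=> _ ->.
case/andP=> xz pz xA nA; have [zA|zA] := boolP (z \in A); first exact: IH pz zA nA.
by exists x, z.
Qed.

Section Seen.
Variables (G : sgraph) (f : G -> Oct) (o : Oct).
Implicit Types (p : Oct) (A B : {set G}).

Definition seen A := [set p : Oct | (p.1 != o.1) && sees f A p].

Lemma sees_setU A B p : sees f (A :|: B) p = sees f A p || sees f B p.
Proof.
apply/seesP/orP => [[x [y [/setUP[xA|xB] fy xy]]]|].
- by left; apply/seesP; exists x, y.
- by right; apply/seesP; exists x, y.
by case=> /seesP[x [y [xA fy xy]]]; exists x, y; rewrite inE xA ?orbT.
Qed.

Lemma seen_setU A B : seen (A :|: B) = seen A :|: seen B.
Proof. by apply/setP => p; rewrite !inE sees_setU -andb_orr. Qed.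

Lemma seen_set0 : seen set0 = set0.
Proof.
apply/setP => p; rewrite !inE; apply/negP => /andP[_ /seesP[x [y []]]].
by rewrite inE.
Qed.

Lemma seen_leq A j k : (forall t, [|| t == o.1, t == j | t == k]) ->
  #|seen A| <= sees f A (j, false) + sees f A (j, true) +
               sees f A (k, false) + sees f A (k, true).
Proof.
move=> cov; pose s := [seq p <- [:: (j, false); (j, true); (k, false); (k, true)] | sees f A p].
have : #|seen A| <= #|s|.
  apply/subset_leq_card/subsetP => -[a b]; rewrite !inE /= => /andP[ao ab].
  rewrite mem_filter ab /=; have := cov a; rewrite (negPf ao) /= !inE.
  by case/orP => /eqP->; case: b {ab}; rewrite eqxx ?orbT.
move/leq_trans; apply; apply: leq_trans (card_size _) _.
by rewrite size_filter /= !addnA addn0.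
Qed.
End Seen.

(** * Shrinking all branch sets to single vertices *)

Section Rounding.
Variable G : sgraph.
Hypothesis noK33 : forall h : G -> bool * option bool, ~ model K33_rel h.
Hypothesis noOct1p : forall h : G -> Oct1p, ~ model (@adj Oct1p) h.
Hypothesis G4 : k_connected 4 G.

(** Together the parts see all four labels off the axis of [o]. If each saw at least two, some two
    labels seen by [B] would have both remaining labels seen by [C]. There are six such pairs: two
    are axes, excluded by the crossing lemma, and four are consecutive, excluded by the other
    one. *)
Lemma split_small (f : G -> Oct) (o : Oct) (B : {set G}) : model (@adj Oct) f ->
  B \subset branch f o -> B != set0 -> branch f o :\: B != set0 ->
  conn B -> conn (branch f o :\: B) ->
  #|seen f o B| <= 1 \/ #|seen f o (branch f o :\: B)| <= 1.
Proof.
move=> fM Bo B0 C0 cB cC; set C := branch f o :\: B in C0 cC *.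
have [|bigB] := leqP #|seen f o B| 1; first by left.
have [|bigC] := leqP #|seen f o C| 1; first by right.
have [j [k [jo ko jk cov]]] := other_axes o.1.
have cover (p : Oct) : p.1 != o.1 -> sees f B p || sees f C p.
  rewrite eq_sym -sees_setU => /(touch_oct fM)/touchP[x [y [fx fy xy]]].
  apply/seesP; exists x, y; split=> //.
  by rewrite !inE fx eqxx andbT orbN.
have cov' t : [|| t == o.1, t == k | t == j] by rewrite [(t == k) || _]orbC.
have kj : k != j by rewrite eq_sym.
have X1 := no_crossing_split fM noK33 Bo B0 C0 cB cC jo ko jk cov.
have X2 := no_crossing_split fM noK33 Bo B0 C0 cB cC ko jo kj cov'.
have N x y := no_noncrossing_split fM noOct1p Bo B0 C0 cB cC (x := x) (y := y) jo ko jk cov.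
move: (leq_trans bigB (seen_leq f B cov)) (leq_trans bigC (seen_leq f C cov)).
move: (cover (j, false) jo) (cover (j, true) jo) (cover (k, false) ko) (cover (k, true) ko).
have {}X1 : sees f B (j, false) -> sees f B (j, true) ->
    sees f C (k, false) -> sees f C (k, true) -> False.
  by move=> *; apply: X1 => -[].
have {}X2 : sees f B (k, false) -> sees f B (k, true) ->
    sees f C (j, false) -> sees f C (j, true) -> False.
  by move=> *; apply: X2 => -[].
move: (N false false) (N false true) (N true false) (N true true) X1 X2 => /=.
move: (sees f B (j, false)) (sees f B (j, true)) (sees f B (k, false)) (sees f B (k, true)).
move: (sees f C (j, false)) (sees f C (j, true)) (sees f C (k, false)) (sees f C (k, true)).
case; case; case; case; case; case; case; case=> //= N1 N2 N3 N4 N5 N6 _ _ _ _ _ _;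
  by [case: (N1 isT isT isT isT) | case: (N2 isT isT isT isT) | case: (N3 isT isT isT isT)
     | case: (N4 isT isT isT isT) | case: (N5 isT isT isT isT) | case: (N6 isT isT isT isT)].
Qed.

Lemma branch_seen_card (f : G -> Oct) (o : Oct) : model (@adj Oct) f -> 3 < #|seen f o (branch f o)|.
Proof.
move=> fM; have [j [k [jo ko jk cov]]] := other_axes o.1.
pose s : seq Oct := [:: (j, false); (j, true); (k, false); (k, true)].
have us : uniq s by rewrite /= !inE !xpair_eqE !eqxx /= (negPf jk).
have <- : size s = 4 by [].
rewrite -(card_uniqP us); apply/subset_leq_card/subsetP => p ps.
have po : p.1 != o.1.
  by move: ps; rewrite !inE => /or4P[] /eqP->.
rewrite inE po /=; move: po; rewrite eq_sym => /(touch_oct fM)/touchP[x [y [fx fy xy]]].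
by apply/seesP; exists x, y; rewrite inE fx eqxx.
Qed.

Lemma center_of_branch (f : G -> Oct) (o : Oct) : model (@adj Oct) f ->
  exists2 x, x \in branch f o & forall y, y \in branch f o -> y != x ->
    #|seen f o (component (branch f o :\ x) y)| <= 1.
Proof.
move=> fM; apply: center_exists.
- exact: seen_set0.
- exact: seen_setU.
- exact: branch_conn.
- exact: branch_seen_card.
- by move=> B Bo B0 C0 cB cC; apply: split_small.
Qed.

Definition singletons (f : G -> Oct) := [set o : Oct | #|branch f o| == 1].

(* Every component of the branch set minus its centre sees a single other branch
   set, which is not a singleton by connectivity; move the component there. *)
Lemma improve (f : G -> Oct) (o : Oct) : model (@adj Oct) f -> 1 < #|branch f o| ->
  exists2 f', model (@adj Oct) f' & #|singletons f| < #|singletons f'|.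
Proof.
move=> fM big; have [x xo center] := center_of_branch o fM.
set V := branch f o in xo center big *.
pose D y := component (V :\ x) y.
have VxP y : (y \in V :\ x) = (f y == o) && (y != x) by rewrite !inE andbC.
pose target y := [pick p in seen f o (D y) | 1 < #|branch f p|].
have fx : f x = o by apply/eqP; move: xo; rewrite inE.
have targetP y : y \in V :\ x -> exists p, [/\ target y = Some p,
    p \in seen f o (D y), 1 < #|branch f p| & forall q, q \in seen f o (D y) -> q = p].
  move=> yVx; have yV : y \in V by move: yVx; rewrite inE => /andP[].
  have yx : y != x by move: yVx; rewrite !inE => /andP[].
  have small := center y yV yx.
  rewrite /target; case: pickP => [p /andP[pD bp]|none].
    by exists p; split=> // q qD; apply/eqP; have := card_le1P small p pD q; rewrite qD => /esym.
  exfalso.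
  have sizes p : p \in seen f o (D y) -> #|branch f p| <= 1.
    by move=> pD; move: (none p); rewrite pD /= ltnNge => /negbFE.
  (* If the component saw no large branch set, then [x] and the at most one vertex of the branch set
     seen would separate it from the antipodal branch set. *)
  have [S [S4 xS Sin Sout]] : exists S : {set G}, [/\ #|S| < 4, x \in S,
      forall v, f v \in seen f o (D y) -> v \in S &
      forall v, v \in S -> v = x \/ f v \in seen f o (D y)].
    have [D0|[p pD]] := set_0Vmem (seen f o (D y)).
      exists [set x]; rewrite cards1 set11; split=> // v.
        by rewrite D0 in_set0.
      by move/set1P; left.
    have pu q : q \in seen f o (D y) -> q = p.
      by move=> qD; apply/eqP; have := card_le1P small p pD q; rewrite qD => /esym.
    exists (x |: branch f p); split.
    - by rewrite cardsU1; have := sizes p pD; case: (x \notin _); lia.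
    - by rewrite !inE eqxx.
    - by move=> v /pu fv; rewrite !inE fv eqxx orbT.
    - move=> v; rewrite !inE => /orP[/eqP|/eqP fv]; [by left|right].
      by rewrite fv; move: pD; rewrite inE.
  have [z fz] : exists z, f z = antipode o by case: fM => surj _ _; apply: surj.
  have fy : f y = o by apply/eqP; move: yV; rewrite inE.
  have yS : y \in ~: S.
    rewrite inE; apply/negP => /Sout[/eqP|]; first by rewrite (negPf yx).
    by rewrite inE fy eqxx.
  have zS : z \in ~: S.
    rewrite inE; apply/negP => /Sout[zx|]; last by rewrite inE fz eqxx.
    by have := antipode_neq o; rewrite -fz zx fx eqxx.
  have zD : z \notin D y.
    by apply/negP => /(subsetP (comp_sub yVx)); rewrite VxP fz (negPf (antipode_neq o)).
  have [u [v [uD vD /and3P[uS vS uv]]]] :=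
    connect_exit (G4.2 S S4 y z yS zS) (mem_comp _ y) zD.
  have uVx := subsetP (comp_sub yVx) _ uD.
  have fu : f u = o by apply/eqP; move: uVx; rewrite VxP => /andP[].
  have vx : v != x by apply: contraNneq vS => ->.
  have [fv|fv] := eqVneq (f v) o.
    have vVx : v \in V :\ x by rewrite VxP fv eqxx.
    by move: vD; rewrite /D -(comp_closed y uVx vVx uv) uD.
  have [fv1|fv1] := eqVneq (f v).1 o.1.
    by move: uv; apply/negP/(opposite_nonadjacent fM noK33); rewrite fu; apply: antipode_eq.
  move/negP: vS; apply; apply: Sin; rewrite inE fv1 /=.
  by apply/seesP; exists u, v.
(* By [targetP] the default [o] is never taken. As [target] depends only on the component, whole
   components move. *)
pose f' y := if y \in V :\ x then odflt o (target y) else f y.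
have f'x : f' x = o by rewrite /f' VxP eqxx andbF.
have f'out y : f y != o -> f' y = f y by rewrite /f' VxP => /negPf->.
have targetD y z : y \in V :\ x -> z \in D y -> z \in V :\ x /\ f' z = f' y.
  move=> yVx zD; have zVx := subsetP (comp_sub yVx) _ zD.
  split=> //; rewrite /f' zVx yVx /target.
  by have -> : D z = D y by apply: comp_eq.
have f'neq y : y \in V :\ x -> f' y != o.
  move=> yVx; have [p [tp + _ _]] := targetP y yVx.
  by rewrite /f' yVx tp inE /= => /andP[+ _]; apply: contra => /eqP->.
have branch_o : branch f' o = [set x].
  apply/setP => y; rewrite !inE; have [->|yx] := eqVneq y x; first by rewrite f'x eqxx.
  have [yVx|nyVx] := boolP (y \in V :\ x); first by rewrite (negPf (f'neq y yVx)).
  by rewrite /f' (negPf nyVx); move: nyVx; rewrite VxP yx andbT => /negPf.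
have branchS p : p != o -> branch f p \subset branch f' p.
  move=> po; apply/subsetP => y; rewrite !inE => /eqP fy.
  by rewrite f'out fy // eqxx.
have touchx y : y \in V :\ x -> exists u, [/\ u \in D y & adj u x].
  move=> yVx; have yV : y \in V by move: yVx; rewrite inE => /andP[].
  have xD : x \notin D y by apply/negP => /(subsetP (comp_sub yVx)); rewrite !inE eqxx.
  have [u [v [/setIP[uV uD] /setDP[vV vD] uv]]] :=
    conn_edge (@branch_conn _ _ fM o) yV (mem_comp _ y) xo xD.
  exists u; split=> //; have [<- //|vx] := eqVneq v x.
  have vVx : v \in V :\ x by rewrite !inE vx; move: vV; rewrite inE.
  have uVx := subsetP (comp_sub yVx) _ uD.
  by move: vD; rewrite /D -(comp_closed y uVx vVx uv) uD.
(* An old edge towards [p] either starts at [x] and survives, or starts in a component that has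
   moved to [p]; then an edge from [x] to that component replaces it. *)
have edge_o p : p.1 != o.1 -> touch f' o p.
  move=> po; have : touch f o p by apply: (touch_oct fM); rewrite eq_sym.
  have po' : p != o by apply: contra po => /eqP->.
  case/touchP=> a [b [fa fb ab]]; apply/touchP.
  have f'b : f' b = p by rewrite f'out fb.
  have [ax|ax] := eqVneq a x; first by exists x, b; rewrite -ax in f'x *.
  have aVx : a \in V :\ x by rewrite VxP fa eqxx.
  have [q [tq _ _ uq]] := targetP a aVx.
  have pq : p = q.
    by apply: uq; rewrite inE po; apply/seesP; exists a, b; rewrite mem_comp.
  have [u [uD ux]] := touchx a aVx; have [uVx fu] := targetD a u aVx uD.
  by exists x, u; rewrite adj_sym f'x fu /f' aVx tq pq.
exists f'.
  split.
  - move=> p; have [->|po] := eqVneq p o; first by exists x.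
    have [a fa] : exists a, f a = p by case: fM => surj _ _; apply: surj.
    by exists a; rewrite f'out fa.
  - apply/fiber_connP => p; rewrite -/(branch f' p).
    have [->|po] := eqVneq p o; first by rewrite branch_o; apply: conn1.
    have [r fr] : exists r, f r = p by case: fM => surj _ _; apply: surj.
    have rp : r \in branch f p by rewrite inE fr.
    have toroot z : z \in branch f p -> connect (rel_in (branch f' p)) r z.
      by move=> zp; apply: connect_inS (branchS p po) (branch_conn fM rp zp).
    apply: (conn_star (subsetP (branchS p po) _ rp)) => y yp.
    have [yVx|nyVx] := boolP (y \in V :\ x); last first.
      by apply: toroot; move: yp; rewrite !inE /f' (negPf nyVx).
    have [q [tq + _ _]] := targetP y yVx.
    have qp : q = p by move: yp; rewrite inE /f' yVx tq => /eqP.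
    rewrite qp inE => /andP[_ /seesP[u [v [uD fv uv]]]].
    have DS : D y \subset branch f' p.
      apply/subsetP => z /(targetD y z yVx)[_ fz].
      by move: yp; rewrite !inE fz.
    have vp : v \in branch f p by rewrite inE fv.
    apply: connect_trans (toroot v vp) _.
    apply: (@connect_trans _ _ u).
      apply: connect1; rewrite rel_inE adj_sym uv andbT.
      by rewrite (subsetP (branchS p po)) //= (subsetP DS).
    by apply: connect_inS DS (comp_conn yVx uD (mem_comp _ y)).
  - move=> p q pq; apply/touchP.
    have {}pq : p.1 != q.1 := pq.
    have [po|po] := eqVneq p o; first by rewrite po; apply: edge_o; rewrite -po eq_sym.
    have [qo|qo] := eqVneq q o.
      by rewrite touch_sym qo; apply: edge_o; rewrite -qo.
    have /touchP[a [b [fa fb ab]]] := touch_oct fM pq.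
    by apply/touchP; exists a, b; rewrite !f'out ?fa ?fb.
(* Components move only into branch sets that already have two vertices, so every old singleton
   persists, and [o] becomes a new one. *)
apply: proper_card; apply/properP; split; last first.
  by exists o; rewrite !inE ?branch_o ?cards1 // neq_ltn big orbT.
apply/subsetP => p; rewrite !inE => p1.
have po : p != o by apply: contraTneq p1 => ->; rewrite neq_ltn big orbT.
suff -> : branch f' p = branch f p by [].
apply/eqP; rewrite eqEsubset branchS // andbT; apply/subsetP => y yp.
have [yVx|nyVx] := boolP (y \in V :\ x); last by move: yp; rewrite !inE /f' (negPf nyVx).
have [q [tq _ bq _]] := targetP y yVx.
have qp : q = p by move: yp; rewrite inE /f' yVx tq => /eqP.
by move: bq; rewrite qp (eqP p1).
Qed.

Lemma injective_model (f : G -> Oct) : model (@adj Oct) f ->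
  exists2 f' : G -> Oct, model (@adj Oct) f' & injective f'.
Proof.
have [n] := ubnP (#|Oct| - #|singletons f|); elim: n f => // n IH f ltn fM.
have [/forallP all1|/forallPn[p hp]] := boolP [forall p, #|branch f p| == 1].
  exists f => // x y fxy; have /cards1P[z ez] := all1 (f x).
  have : x \in branch f (f x) by rewrite inE.
  have : y \in branch f (f x) by rewrite inE fxy.
  by rewrite ez !inE => /eqP-> /eqP->.
have [r fr] : exists r, f r = p by case: fM => surj _ _; apply: surj.
have big : 1 < #|branch f p|.
  rewrite ltn_neqAle eq_sym hp; apply/card_gt0P; exists r.
  by rewrite inE fr.
have [f' f'M lt] := improve fM big; apply: IH f'M.
rewrite ltnS in ltn; apply: leq_trans ltn; apply: ltn_sub2l => //.
exact: leq_trans lt (max_card _).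
Qed.

Lemma isomorphic_oct (f : G -> Oct) : model (@adj Oct) f -> isomorphic G Oct.
Proof.
case/injective_model=> f' f'M injf; have [surj _ edge] := f'M.
exists f'; split.
  apply: inj_card_bij => //.
  have [g gK] : exists g : Oct -> G, cancel g f'.
    exists (fun h => xchoose (P := fun x => f' x == h)
      (let: ex_intro x fx := surj h in ex_intro _ x (introT eqP fx))).
    by move=> h; apply/eqP/(xchooseP (P := fun x => f' x == h)).
  exact: leq_card (can_inj gK).
move=> x y; apply/idP/idP => [/edge[a [b [/injf-> /injf-> //]]]|xy].
have [e1|//] := eqVneq (f' x).1 (f' y).1.
have fxy : f' y != f' x.
  by apply: contraTneq xy => /injf->; rewrite adj_irrefl.
by have := opposite_nonadjacent f'M noK33 (antipode_eq (esym e1) fxy); rewrite xy.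
Qed.
End Rounding.

Lemma isomorphic_trans G1 G2 G3 : isomorphic G1 G2 -> isomorphic G2 G3 -> isomorphic G1 G3.
Proof.
move=> [f [bf mf]] [g [bg mg]]; exists (g \o f); split; first exact: bij_comp.
by move=> x y /=; rewrite mg mf.
Qed.

(* The colour class of a vertex of [C62] is its residue modulo 3. *)
Lemma oct_C62 : isomorphic Oct C62.
Proof.
pose f (x : Oct) : C62 := inZp (x.1 + 3 * x.2).
have fval (x : Oct) : val (f x) = x.1 + 3 * x.2.
  by rewrite /= modn_small //; case: x => [[[|[|[|]]] //= i] []].
have injf : injective f.
  move=> [[i i3] b] [[j j3] c] /(congr1 val); rewrite !fval /= => e.
  have [ij bc] : i = j /\ b = c.
    by move: i3 j3 e; case: b; case: c => /= i3 j3 e; split=> //; lia.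
  by rewrite bc; congr pair; apply: val_inj.
exists f; split.
  by apply: inj_card_bij => //; rewrite card_prod !card_ord card_bool.
by move=> [[[|[|[|]]] // i] []] [[[|[|[|]]] // j] []]; vm_compute.
Qed.

(** * Existence of an octahedron model *)

Lemma exists_minimal (T : Type) (P : T -> Prop) (mu : T -> nat) x :
  P x -> exists2 y, P y & forall z, P z -> mu y <= mu z.
Proof.
have [n] := ubnP (mu x); elim: n x => // n IH x ltn Px.
case: (boolp.EM (exists2 y, P y & mu y < mu x)) => [[y Py lt]|no].
  by apply: (IH y) => //; apply: leq_trans lt _.
exists x => // z Pz; rewrite leqNgt; apply/negP => lt; apply: no.
by exists z.
Qed.

(** * Separators and theta graphs in a 4-connected graph *)

Section FourConnected.
Variable G : sgraph.
Hypothesis G4 : k_connected 4 G.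
Implicit Types (x y z t u v : G) (s a b c p : seq G) (A S T : {set G}).

Lemma conn_compl S : #|S| < 4 -> conn (~: S).
Proof.
move=> S4 x y xS yS; apply: connect_sub (G4.2 S S4 x y xS yS) => u v.
by case/and3P=> uS vS uv; apply: connect1; rewrite rel_inE !inE uS vS.
Qed.

Lemma vertex_outside S : #|S| <= 4 -> exists x, x \notin S.
Proof.
move=> S4; have : 0 < #|~: S|.
  by rewrite cardsCs setCK subn_gt0; apply: leq_ltn_trans S4 G4.1.
by case/card_gt0P => x; rewrite inE => xS; exists x.
Qed.

Lemma degree_geq4 x : 3 < #|[set z | adj x z]|.
Proof.
rewrite ltnNge; apply/negP => N3; set N := [set z | _] in N3.
have [g] : exists g, g \notin x |: N.
  by apply: vertex_outside; rewrite cardsU1; case: (_ \notin _) => /=; rewrite ?add1n ?add0n ?ltnS // leqW.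
rewrite !inE negb_or => /andP[gx gN].
have xN : x \in ~: N by rewrite !inE adj_irrefl.
have gN' : g \in ~: N by rewrite !inE.
have gx' : g \notin [set x] by rewrite inE.
have [u [v [/setIP[_ /set1P ux] /setDP[vN _] uv]]] :=
  conn_edge (conn_compl N3) xN (set11 x) gN' gx'.
by move: vN; rewrite !inE -ux uv.
Qed.

(** As [G - S] is connected, the component can be left within it, and this is possible only by
    stepping onto [T]. *)
Lemma component_touches S T x y : #|S| < 4 -> x \in ~: (S :|: T) -> y \in T ->
  y \notin S -> exists z t, [/\ z \in component (~: (S :|: T)) x, t \in T,
    t \notin S & adj z t].
Proof.
move=> S4 xO yT yS; set D := component _ x.
have xS : x \in ~: S by move: xO; rewrite !inE negb_or => /andP[].
have yS' : y \in ~: S by rewrite inE.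
have DO : D \subset ~: (S :|: T) := comp_sub xO.
have yD : y \notin D by apply/negP => /(subsetP DO); rewrite !inE yT orbT.
have [u [v [/setIP[uS uD] /setDP[vS vD] uv]]] :=
  conn_edge (conn_compl S4) xS (mem_comp _ x : x \in D) yS' yD.
exists u, v; split=> //; last by move: vS; rewrite inE.
apply/negPn/negP => vT.
have vO : v \in ~: (S :|: T) by move: vS; rewrite !inE negb_or vT andbT.
by move: vD; rewrite /D -(comp_closed x (subsetP DO _ uD) vO uv) uD.
Qed.

Lemma connect_path A x y : x \in A -> connect (rel_in A) x y ->
  exists p, [/\ path (@adj _) x p, last x p = y, uniq (x :: p) &
    {subset x :: p <= A}].
Proof.
move=> xA /connectP[p0 /shortenP[p pp up _] ->]; exists p; split=> //.
  by apply: sub_path pp => u v; rewrite rel_inE => /and3P[].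
move=> z; rewrite inE => /orP[/eqP->//|].
elim: p x xA pp {up} => //= t p IH x xA /andP[/and3P[_ tA _] pp].
by rewrite inE => /orP[/eqP->//|]; apply: IH pp.
Qed.

Lemma path_conn x p : path (@adj _) x p -> conn [set y in x :: p].
Proof.
elim: p x => [|y p IH] x /=.
  by move=> _ a b; rewrite !inE => /eqP-> /eqP->; apply: connect0.
case/andP=> xy /IH cp.
have -> : [set z in x :: y :: p] = [set x] :|: [set z in y :: p].
  by apply/setP => z; rewrite !inE.
by apply: (connU (x := x) (y := y)) xy => //; rewrite ?inE ?eqxx //; apply: conn1.
Qed.

Lemma path_rcons_rev u v c :
  path (@adj _) u (rcons c v) -> path (@adj _) v (rcons (rev c) u).
Proof.
move=> pc; have := rev_path (@adj _) u (rcons c v).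
rewrite last_rcons belast_rcons rev_cons => ->.
by apply: sub_path pc => x y; rewrite adj_sym.
Qed.

Section Parity.
Variables (m : G -> G -> G -> bool) (l : rel G).
Hypothesis mC : forall z x y, m z x y = m z y x.
Hypothesis lN : forall x y, x != y -> l x y = ~~ l y x.
Hypothesis mP : forall x y z t, adj x y -> adj z t ->
  x \notin [:: z; t] -> y \notin [:: z; t] ->
  crossing_parity m x y z t = order_parity l x y z t.
Notation I := (cycle_parity m).

Lemma parity_edge s x y : cycle (@adj _) s -> adj x y -> x \notin s -> y \notin s ->
  I x s = I y s.
Proof.
case: s => // z s cs xy xs ys.
apply: (cycle_parity_const (t := [:: y]) mP _ cs); first by rewrite /= xy.
by move=> t ts; rewrite !inE => /orP[] /eqP e; move: xs ys; rewrite -e ts.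
Qed.

Lemma parity_connect s A x y : cycle (@adj _) s -> {in A, forall z, z \notin s} ->
  connect (rel_in A) x y -> I x s = I y s.
Proof.
move=> cs As /connectP[p + ->]; elim: p x => //= z p IH x /andP[/and3P[xA zA xz] /IH <-].
by apply: parity_edge; rewrite ?As.
Qed.

Lemma parity_path s x p t : cycle (@adj _) s -> path (@adj _) x p ->
  {in x :: p, forall z, z \notin s} -> t \in x :: p -> I t s = I x s.
Proof.
move=> cs pp ps tp; apply: (@parity_connect s [set z in x :: p]) => //.
  by move=> z; rewrite inE; apply: ps.
by apply: (path_conn pp); rewrite inE // inE eqxx.
Qed.

(* Three internally disjoint paths with interiors [a], [rev b], [c] from [u] to [v]. *)
Definition theta u v a b c := [/\ uniq (u :: v :: a ++ b ++ c),
  path (@adj _) u (rcons a v), path (@adj _) v (rcons b u) &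
  path (@adj _) u (rcons c v)].

Lemma theta_cycles u v a b c : theta u v a b c ->
  [/\ cycle (@adj _) (u :: a ++ v :: b), cycle (@adj _) (u :: a ++ v :: rev c) &
      cycle (@adj _) (u :: c ++ v :: b)].
Proof.
by case=> _ pa pb pc; rewrite /cycle !path_mid pa pb pc (path_rcons_rev pc).
Qed.

(** The path [c] is traversed once in each direction by the two cycles on the right, so its
    contributions cancel. *)
Lemma theta_add u v a b c x :
  I x (u :: a ++ v :: b) = I x (u :: a ++ v :: rev c) (+) I x (u :: c ++ v :: b).
Proof.
rewrite !cycle_parity2 (walk_parity_rcons_rev mC).
move: (walk_parity _ _ _ _) (walk_parity _ _ _ _) (walk_parity _ _ _ _).
by do 3!case.
Qed.

Lemma theta_swap u v a b c : theta u v a b c -> theta v u b a (rev c).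
Proof.
case=> U pa pb pc; split=> //; last exact: path_rcons_rev.
rewrite (perm_uniq (s2 := u :: v :: a ++ b ++ c)) //.
by apply/permP => q; rewrite /= !count_cat count_rev; lia.
Qed.

Lemma theta_key u v a b c x1 x2 x3 : theta u v a b c ->
  x1 \in a -> x2 \in b -> x3 \in c ->
  I x1 (u :: c ++ v :: b) (+) I x2 (u :: a ++ v :: rev c) (+)
  I x3 (u :: a ++ v :: b) = true.
Proof.
case=> + + + + /splitPr x1a /splitPr x2b /splitPr x3c.
case: x1a => a1 a2; case: x2b => b1 b2; case: x3c => c1 c2 U pa pb pc.
exact: (theta_parity mC lN mP).
Qed.
End Parity.
End FourConnected.

(** * Optimal cycles around the vertex [w] *)

Section Link.
Variable G : sgraph.
Hypothesis G4 : k_connected 4 G.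
Variables (m : G -> G -> G -> bool) (l : rel G).
Hypothesis mC : forall z x y, m z x y = m z y x.
Hypothesis lN : forall x y, x != y -> l x y = ~~ l y x.
Hypothesis mP : forall x y z t, adj x y -> adj z t ->
  x \notin [:: z; t] -> y \notin [:: z; t] ->
  crossing_parity m x y z t = order_parity l x y z t.
Variable w : G.
Implicit Types (x y z t u v : G) (s a b c p : seq G) (A S T : {set G}).
Notation I := (cycle_parity m).
Arguments cycle_parity : simpl never.

Definition good s := [/\ cycle (@adj _) s, uniq s, 2 < size s & w \notin s].
Definition same_side s := [set x | [&& x \notin s, x != w & I x s == I w s]].
(* Lexicographic order on (#|same_side s|, size s), as size s <= #|G|. *)
Definition weight s := #|same_side s| * #|G|.+1 + size s.
Definition optimal s := good s /\ forall s', good s' -> weight s <= weight s'.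

Lemma good_rot s p : good (s ++ p) -> good (p ++ s).
Proof.
rewrite -(rot_size_cat s p) => -[? ? ? ?].
by split; rewrite ?rot_cycle ?rot_uniq ?size_rot ?mem_rot.
Qed.

Lemma same_side_rot s p : same_side (s ++ p) = same_side (p ++ s).
Proof.
by apply/setP => x; rewrite !inE !mem_cat orbC !(cycle_parity_rot m _ s p).
Qed.

Lemma optimal_rot s p : optimal (s ++ p) -> optimal (p ++ s).
Proof.
case=> gs opt; split; first exact: good_rot.
by move=> s' /opt; rewrite /weight same_side_rot !size_cat [size s + _]addnC.
Qed.

Lemma optimal_not_improved s s' : optimal s -> good s' ->
  same_side s' \subset same_side s ->
  same_side s' != same_side s \/ size s' < size s -> False.
Proof.
move=> [[_ us _ _] opt] gs' sub; have [_ us' _ _] := gs'.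
have := opt _ gs'; rewrite /weight.
have size_le p : uniq p -> size p <= #|G|.
  by move=> /card_uniqP <-; apply: max_card.
move: (size_le s us) (size_le s' us') (subset_leq_card sub) => s1 s2 s3 s4 [ne|lt].
  have : #|same_side s'| < #|same_side s|.
    by apply: proper_card; rewrite properEneq ne.
  move: s1 s2 s4; clear; generalize #|same_side s'|, #|same_side s|, (size s), (size s'), #|G|.
  by move=> o' o k k' n k1 k2 h lt; have := leq_mul lt (leqnn n.+1); lia.
have := leq_mul s3 (leqnn #|G|.+1); move: s4 lt; clear; lia.
Qed.

(** The set [{u, v, w}] does not separate, so the component of [x] off the theta and [w] is attached
    to an inner vertex [t] of one of the paths; [x] and [t] lie on the same side of any cycle in the
    theta that avoids [t]. *)
Lemma off_theta u v a b c x : theta u v a b c -> a ++ b ++ c != [::] ->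
  w \notin u :: v :: a ++ b ++ c -> x \notin u :: v :: a ++ b ++ c -> x != w ->
  exists2 t, t \in a ++ b ++ c & forall s, cycle (@adj _) s ->
    {subset s <= u :: v :: a ++ b ++ c} -> t \notin s -> I x s = I t s.
Proof.
move=> [U _ _ _] n0 wth xth xw; set th := _ :: _ in U wth xth *.
pose S := u |: (v |: [set w]); pose T := [set z in a ++ b ++ c].
have S4 : #|S| < 4.
  by rewrite /S !cardsU1 cards1; case: (_ \notin _); case: (_ \notin _).
have [y yT] : exists y, y \in a ++ b ++ c.
  by case: (a ++ b ++ c) n0 => // y p _; exists y; rewrite inE eqxx.
have yS : y \notin S.
  rewrite !inE !negb_or; move: U wth; rewrite /th /= !inE !negb_or => /and3P[/andP[_ uy] vy _].
  case/and3P=> _ _ wy; apply/and3P; split; apply: contraTneq yT => -> //.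
have xO : x \in ~: (S :|: T).
  move: xth xw; rewrite /th !inE !negb_or => /and3P[-> -> ->] ->.
  by [].
have yT' : y \in T by rewrite inE.
have [z [t [zx tT tS zt]]] := component_touches G4 S4 xO yT' yS.
exists t; first by move: tT; rewrite inE.
move=> s cs sub ts.
have off : {in ~: (S :|: T), forall y, y \notin s}.
  move=> r; rewrite !inE !negb_or => /andP[/and3P[ru rv _] rT].
  by apply/negP => /sub; rewrite /th !inE (negPf ru) (negPf rv) (negPf rT).
have zO := subsetP (comp_sub xO) _ zx.
have zx' : connect (rel_in (~: (S :|: T))) x z by move: zx; rewrite inE.
by rewrite (parity_connect mP cs off zx'); apply: (parity_edge mP cs zt) => //; apply: off.
Qed.

(* The cycle through [a] and [c] beats the one through [a] and [b]: by 3-connectivity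
   of [G - w], a vertex off the theta is attached to the interior of one of the
   three paths, which determines its side. *)
Lemma reroute_left u v a b c : optimal (u :: a ++ v :: b) -> theta u v a b c ->
  w \notin c -> a ++ c != [::] -> b ++ c != [::] ->
  {in a, forall t, I t (u :: c ++ v :: b) = I w (u :: c ++ v :: b)} ->
  {in b, forall t, I t (u :: a ++ v :: rev c) = ~~ I w (u :: a ++ v :: rev c)} ->
  {in c, forall t, I t (u :: a ++ v :: b) = I w (u :: a ++ v :: b)} -> False.
Proof.
move=> opt th wc ac bc Ha Hb Hc; have [c12 c13 c23] := theta_cycles th.
have [U _ _ _] := th; have [[_ _ _ ws] _] := opt.
have wth : w \notin u :: v :: a ++ b ++ c.
  move: ws wc; rewrite !(inE, mem_cat) !negb_or => /andP[-> /and3P[-> -> ->]] ->.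
  by [].
have good13 : good (u :: a ++ v :: rev c).
  split=> //.
  - have : uniq ((u :: a ++ v :: rev c) ++ b).
      rewrite (perm_uniq (s2 := u :: v :: a ++ b ++ c)) //.
      apply/permP => q; rewrite /= ?count_cat /= ?count_cat /= ?count_rev.
      clear; lia.
    by rewrite cat_uniq => /andP[].
  - rewrite /= size_cat /= size_rev addnS.
    by case: a ac {opt th Ha Hb Hc c12 c13 c23 U ws wth} => //; case: c bc wc.
  - move: wth; rewrite !(inE, mem_cat) mem_rev !negb_or.
    by case/and5P=> -> -> -> _ ->.
apply: (optimal_not_improved opt good13).
  apply/subsetP => x; rewrite !inE => /and3P[x13 xw /eqP Ix]; rewrite xw /=.
  have xb : x \notin b.
    by apply/negP => /Hb; rewrite Ix; case: (I w _).
  have -> /= : x \notin u :: a ++ v :: b.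
    by move: x13; rewrite !(inE, mem_cat) (negPf xb) !negb_or => /and4P[-> -> -> _].
  have [xc|xc] := boolP (x \in c); first by rewrite Hc.
  have xth : x \notin u :: v :: a ++ b ++ c.
    move: x13; rewrite !(inE, mem_cat) (negPf xb) (negPf xc) !negb_or.
    by case/and4P=> -> -> -> _.
  have abc : a ++ b ++ c != [::] by case: (a) (b) bc => // -[].
  have [t tth Ht] := off_theta th abc wth xth xw.
  have Uc := uniq_count_le1 t U.
  have tin (q : seq G) : (t \in q) = (0 < count_mem t q).
    by rewrite -has_count has_pred1.
  (* Attached to [a], the vertex [x] agrees with [w] on both cycles through [c], whose parities add
     up to that of the old cycle. Attached to [b], it would be separated from [w] by the new cycle.
     Attached to [c], it agrees with [w] on the old cycle by [Hc]. *)
  move: tth; rewrite !mem_cat => /or3P[] tq.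
  - rewrite !(theta_add mC u v a b c) -Ix (Ht (u :: c ++ v :: b)) ?Ha //.
    + by move=> r; rewrite !(inE, mem_cat) => /or4P[] ->; rewrite ?orbT.
    + move: Uc tq; rewrite !tin /= !count_cat /=; generalize_nats; clear; lia.
  - have := Hb t tq; rewrite -(Ht (u :: a ++ v :: rev c)) // ?Ix; first by case: (I w _).
    + by move=> r; rewrite !(inE, mem_cat) mem_rev => /or4P[] ->; rewrite ?orbT.
    + move: Uc tq; rewrite !tin /= !count_cat /= count_rev; generalize_nats; clear; lia.
  - rewrite (Ht (u :: a ++ v :: b)) ?Hc //.
    + by move=> r; rewrite !(inE, mem_cat) => /or4P[] ->; rewrite ?orbT.
    + move: Uc tq; rewrite !tin /= !count_cat /=; generalize_nats; clear; lia.
(* This is where both parts of the weight matter. A vertex of [c] leaves the side of [w] by joining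
   the cycle; if [c] is a chord, the side may stay the same but the cycle becomes shorter. *)
have [c0|[t tc]] : c = [::] \/ exists t, t \in c.
  by case: (c) => [|t q]; [left | right; exists t; rewrite inE eqxx].
  right; move: bc; rewrite c0 cats0 -size_eq0 /= !size_cat /=.
  by clear; lia.
left; apply/eqP => /setP/(_ t); rewrite !inE (Hc t tc) eqxx andbT.
have Uc := uniq_count_le1 t U.
have tin (q : seq G) : (t \in q) = (0 < count_mem t q).
  by rewrite -has_count has_pred1.
have -> : t \notin u :: a ++ v :: rev c = false.
  by rewrite !(inE, mem_cat) mem_rev tc !orbT.
have -> : t \notin u :: a ++ v :: b.
  move: Uc tc; rewrite !tin /= !count_cat /=; generalize_nats; clear; lia.
by case: eqP wc => //= <-; rewrite tc.
Qed.

Lemma cycle_parity_swap x u v p q : I x (u :: p ++ v :: q) = I x (v :: q ++ u :: p).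
Proof. exact: (cycle_parity_rot m x (u :: p) (v :: q)). Qed.

Lemma optimal_swap u v p q : optimal (u :: p ++ v :: q) -> optimal (v :: q ++ u :: p).
Proof. exact: (@optimal_rot (u :: p) (v :: q)). Qed.

Lemma reroute_right u v a b c : optimal (u :: a ++ v :: b) -> theta u v a b c ->
  w \notin c -> a ++ c != [::] -> b ++ c != [::] ->
  {in b, forall t, I t (u :: a ++ v :: rev c) = I w (u :: a ++ v :: rev c)} ->
  {in a, forall t, I t (u :: c ++ v :: b) = ~~ I w (u :: c ++ v :: b)} ->
  {in c, forall t, I t (u :: a ++ v :: b) = I w (u :: a ++ v :: b)} -> False.
Proof.
move=> /optimal_swap opt /theta_swap th wc ac bc Hb Ha Hc.
have rc0 (p q : seq G) : (p ++ rev q == [::]) = (p ++ q == [::]).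
  by rewrite -!size_eq0 !size_cat size_rev.
apply: (reroute_left opt th); rewrite ?mem_rev ?rc0 //.
- by move=> t tb; rewrite !(cycle_parity_swap _ v u); apply: Hb.
- by move=> t ta; rewrite revK !(cycle_parity_swap _ v u); apply: Ha.
- by move=> t; rewrite mem_rev => tc; rewrite !(cycle_parity_swap _ v u); apply: Hc.
Qed.

Lemma theta_const_left u v a b c t t' : theta u v a b c -> t \in a -> t' \in a ->
  I t (u :: c ++ v :: b) = I t' (u :: c ++ v :: b).
Proof.
move=> th; have [_ _ c23] := theta_cycles th; case: th => U pa _ _.
case: a U pa => // y a U /=; rewrite rcons_path => /andP[_ /andP[pa _]].
have off : {in y :: a, forall z, z \notin u :: c ++ v :: b}.
  move=> z za; have Uc := uniq_count_le1 z U; apply/negP => zs; move: Uc za zs.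
  rewrite -!has_pred1 !has_count /= !count_cat /= ?count_cat /=; clear; lia.
by move=> ta ta'; rewrite !(parity_path mP c23 pa off).
Qed.

Lemma theta_const_right u v a b c t t' : theta u v a b c -> t \in b -> t' \in b ->
  I t (u :: a ++ v :: rev c) = I t' (u :: a ++ v :: rev c).
Proof.
by move=> /theta_swap th tb tb'; rewrite !(cycle_parity_swap _ u v) (theta_const_left th tb tb').
Qed.

(** By [theta_add] for [w], the first hypothesis says that exactly one of [a] and [b] lies on the
    side of [w] with respect to the cycle formed by the other two paths. The other one is replaced
    by [c]. If [a] or [b] is empty, the vertices of the remaining one decide. *)
Lemma reroute u v a b c : optimal (u :: a ++ v :: b) -> theta u v a b c ->
  w \notin c -> a ++ c != [::] -> b ++ c != [::] ->
  {in a & b, forall t t', I t (u :: c ++ v :: b) (+) I t' (u :: a ++ v :: rev c) =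
    ~~ I w (u :: a ++ v :: b)} ->
  {in c, forall t, I t (u :: a ++ v :: b) = I w (u :: a ++ v :: b)} -> False.
Proof.
move=> opt th wc ac bc key Hc.
have add := theta_add mC u v a b c w.
have right_eq t : t \in b -> (forall t', t' \in b ->
    I t' (u :: a ++ v :: rev c) = I t (u :: a ++ v :: rev c)).
  by move=> tb t' tb'; apply: theta_const_right th tb' tb.
have left_eq t : t \in a -> (forall t', t' \in a ->
    I t' (u :: c ++ v :: b) = I t (u :: c ++ v :: b)).
  by move=> ta t' ta'; apply: theta_const_left th ta' ta.
have [[t tb]|nb] : (exists t, t \in b) \/ b = [::].
  by case: (b) => [|y p]; [right | left; exists y; rewrite inE eqxx].
  have [e|e] := boolP (I t (u :: a ++ v :: rev c) == I w (u :: a ++ v :: rev c)).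
    apply: (reroute_right opt th) => // t' ht'; first by rewrite (right_eq t) // (eqP e).
    have := key _ _ ht' tb; rewrite (eqP e) add.
    by move: (I t' _) (I w _) (I w _); do 3!case.
  apply: (reroute_left opt th) => // t' ht'; last first.
    by rewrite (right_eq t) //; move: e; move: (I t _) (I w _); do 2!case.
  have := key _ _ ht' tb; rewrite add; move: e.
  by move: (I t _) (I t' _) (I w _) (I w _); do 4!case.
have [[t ta]|na] : (exists t, t \in a) \/ a = [::].
  by case: (a) => [|y p]; [right | left; exists y; rewrite inE eqxx].
  have [e|e] := boolP (I t (u :: c ++ v :: b) == I w (u :: c ++ v :: b)).
    apply: (reroute_left opt th) => // t' ht'; first by rewrite (left_eq t) // (eqP e).
    by move: ht'; rewrite nb.
  apply: (reroute_right opt th) => // t' ht'; first by move: ht'; rewrite nb.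
  by rewrite (left_eq t) //; move: e; move: (I t _) (I w _); do 2!case.
by have [[_ _ + _] _] := opt; rewrite na nb.
Qed.

Notation off s := (~: ([set w] :|: [set z in s])).

Lemma offE s x : (x \in off s) = (x != w) && (x \notin s).
Proof. by rewrite !inE negb_or. Qed.

Lemma split_cycle s u v : optimal s -> u \in s -> v \in s -> u != v ->
  exists a b, [/\ optimal (u :: a ++ v :: b), u :: a ++ v :: b =i s &
    forall x, I x (u :: a ++ v :: b) = I x s].
Proof.
move=> opt us vs uv; have /splitPr us' := us.
case: us' opt vs => p q opt vs.
have opt' : optimal (u :: q ++ p) by apply: (optimal_rot opt).
have par_eq x : I x (u :: q ++ p) = I x (p ++ u :: q).
  exact: (cycle_parity_rot m x (u :: q) p).
have mem_eq : u :: q ++ p =i p ++ u :: q.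
  by move=> z; rewrite -cat_cons !mem_cat orbC.
have : v \in q ++ p.
  by move: vs; rewrite -mem_eq inE eq_sym (negPf uv).
move/splitPr => qp; case E: _ / qp opt' mem_eq par_eq => [a b] opt' mem_eq par_eq.
by exists a, b.
Qed.

Lemma component_theta u v a b x z1 z2 : good (u :: a ++ v :: b) ->
  x \in off (u :: a ++ v :: b) ->
  z1 \in component (off (u :: a ++ v :: b)) x -> adj z1 u ->
  z2 \in component (off (u :: a ++ v :: b)) x -> adj z2 v ->
  exists c, [/\ theta u v a b c, w \notin c, z1 \in c &
    {subset c <= component (off (u :: a ++ v :: b)) x}].
Proof.
set s := u :: _; set D := component _ x.
move=> [cs us _ ws] xo z1D z1u z2D z2v.
have DO : D \subset off s := comp_sub xo.
have [p [pp lp up sp]] := connect_path z1D (comp_conn xo z1D z2D).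
exists (z1 :: p); split; first 1 last.
- by apply/negP => /sp/(subsetP DO); rewrite offE eqxx.
- by rewrite inE eqxx.
- exact: sp.
move: cs; rewrite /s /cycle path_mid => /andP[pa pb]; split=> //.
  have : uniq (s ++ z1 :: p).
    rewrite cat_uniq us up andbT; apply/hasPn => z /sp/(subsetP DO).
    by rewrite offE => /andP[].
  rewrite (perm_uniq (s2 := u :: v :: a ++ b ++ z1 :: p)) //.
  by apply/permP => q; rewrite /= ?count_cat /= ?count_cat /=; clear; lia.
by rewrite /= adj_sym z1u /= rcons_path pp lp.
Qed.

(** Once a first attachment [u] is found, deleting it along with [w] still leaves a connected graph,
    and this forces a second attachment. *)
Lemma two_attachments s x : good s -> x \in off s ->
  exists u v z1 z2, [/\ u \in s, v \in s, u != v &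
    [/\ z1 \in component (off s) x, adj z1 u, z2 \in component (off s) x & adj z2 v]].
Proof.
move=> [_ us s2 ws] xo.
have [y ys] : exists y, y \in s.
  by case: (s) s2 => // y p _; exists y; rewrite inE eqxx.
have yw : y \notin [set w] by rewrite inE; apply: contraNneq ws => <-.
have yT : y \in [set z in s] by rewrite inE.
have [|z1 [u [z1D us' _ z1u]]] := component_touches G4 _ xo yT yw; first by rewrite cards1.
have {}us' : u \in s by rewrite inE in us'.
have [y' y's y'u] : exists2 y', y' \in s & y' != u.
  case: (s) us s2 => [|y1 [|y2 p]] //= /andP[]; rewrite inE negb_or => /andP[n12 _] _ _.
  have [<-|n] := eqVneq y1 u; first by exists y2; rewrite 1?eq_sym ?inE ?eqxx ?orbT.
  by exists y1; rewrite ?inE ?eqxx.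
have eqS : ~: ((u |: [set w]) :|: [set z in s]) = off s.
  apply/setP => z; rewrite !inE; case: (z =P u) => //= ->.
  by rewrite us' orbT.
have xo' : x \in ~: ((u |: [set w]) :|: [set z in s]) by rewrite eqS.
have y'T : y' \in [set z in s] by rewrite inE.
have y'w : y' \notin u |: [set w].
  by rewrite !inE (negPf y'u) /=; apply: contraNneq ws => <-.
have [|z2 [v [z2D vs' vn z2v]]] := component_touches G4 _ xo' y'T y'w.
  by rewrite cardsU1 cards1; case: (_ \notin _).
have {}vs' : v \in s by rewrite inE in vs'.
have uv : u != v by move: vn; rewrite !inE negb_or eq_sym => /andP[].
rewrite eqS in z2D.
by exists u, v, z1, z2.
Qed.

(** A vertex [x] on the side of [w] lies in a component with two attachments on [s]. A path through
    that component is the third path of a theta and runs on the side of [w], so the cycle could be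
    rerouted. *)
Lemma optimal_separates s x : optimal s -> x \notin s -> x != w -> I x s = ~~ I w s.
Proof.
move=> opt xs xw.
case: (boolP (I x s == I w s)) => [/eqP e|]; last by case: (I x s) (I w s) => [] [].
exfalso; have xo : x \in off s by rewrite offE xw.
have [u [v [z1 [z2 [us' vs' uv [z1D z1u z2D z2v]]]]]] := two_attachments (proj1 opt) xo.
have [a [b [opt' eqs eqI]]] := split_cycle opt us' vs' uv.
have eqoff : off s = off (u :: a ++ v :: b).
  by apply/setP => z; rewrite !offE eqs.
rewrite eqoff in z1D z2D xo.
have [c [th wc z1c cD]] := component_theta (proj1 opt') xo z1D z1u z2D z2v.
have c0 (p : seq G) : p ++ c != [::].
  by apply: contraTneq z1c => /(congr1 size)/eqP; rewrite size_cat addn_eq0 => /andP[_ /nilP->].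
have [c12 _ _] := theta_cycles th.
have Ic t : t \in c -> I t (u :: a ++ v :: b) = I w (u :: a ++ v :: b).
  move=> /cD; rewrite inE => xt; rewrite !eqI -e -!eqI; apply/esym.
  by apply: (parity_connect mP c12 _ xt) => z; rewrite offE => /andP[].
apply: (reroute opt' th wc (c0 a) (c0 b)) => // t t' ta tb.
have := theta_key mC lN mP th ta tb z1c; rewrite (Ic _ z1c).
by move: (I t _) (I t' _) (I w _); do 3!case.
Qed.

Lemma optimal_across u v y t (a1 a2 b1 b2 : seq G) :
  optimal (u :: (a1 ++ y :: a2) ++ v :: b1 ++ t :: b2) ->
  optimal (y :: (a2 ++ v :: b1) ++ t :: (b2 ++ u :: a1)).
Proof.
have -> : y :: (a2 ++ v :: b1) ++ t :: b2 ++ u :: a1 =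
  (y :: a2 ++ v :: b1 ++ t :: b2) ++ (u :: a1) by rewrite /= -!catA /= -!catA.
by rewrite -catA; apply: (@optimal_rot (u :: a1)).
Qed.

(** Let [X] consist of [a] and of all components attached to [a]. Since [{u, v, w}] does not
    separate [t] from [g], some edge leaves [X] while avoiding these three vertices. Its far end
    cannot be off the cycle, as its component would then be attached to [a]; so it is in [b]. *)
Lemma bridge_exit u v a b t g : optimal (u :: a ++ v :: b) -> t \in a ->
  g \notin [:: u; v; w] -> g \notin a ->
  (forall z y, z \in component (off (u :: a ++ v :: b)) g -> y \in a ->
    g \in off (u :: a ++ v :: b) -> ~~ adj z y) ->
  exists y t2, [/\ t2 \in b, adj y t2 & y \in a \/
    y \in off (u :: a ++ v :: b) /\ exists z t1,
      [/\ z \in component (off (u :: a ++ v :: b)) y, t1 \in a & adj z t1]].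
Proof.
set s := u :: _ => opt ta gS ga gD; have [[_ us _ ws] _] := opt.
pose X := [set y | (y \in a) || (y \in off s) &&
  [exists z in component (off s) y, exists t1, (t1 \in a) && adj z t1]].
pose S := u |: (v |: [set w]).
have S4 : #|S| < 4.
  by rewrite /S !cardsU1 cards1; case: (_ \notin _); case: (_ \notin _).
have SE y : (y \in ~: S) = (y \notin [:: u; v; w]) by rewrite !inE.
have XE y : (y \in X) = (y \in a) || (y \in off s) &&
    [exists z in component (off s) y, exists t1, (t1 \in a) && adj z t1].
  by rewrite in_set.
clearbody X.
have tS : t \in ~: S.
  rewrite SE !inE !negb_or; have := uniq_count_le1 t us; move: (ta).
  rewrite -has_pred1 has_count /s /= count_cat /= => t0 t1.
  apply/and3P; split.
  - by apply/eqP => e; move: t0 t1; rewrite e eqxx; clear; lia.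
  - by apply/eqP => e; move: t0 t1; rewrite e eqxx; clear; lia.
  - by apply: contraNneq ws => <-; rewrite inE mem_cat ta orbT.
have tX : t \in X by rewrite XE ta.
have gX : g \notin X.
  rewrite XE (negPf ga) /=; apply/negP => /andP[go /exists_inP[z zD /existsP[y /andP[ya zy]]]].
  by move: zy; apply/negP; apply: gD.
rewrite -SE in gS.
have [y [t2 [/setIP[yS yX] /setDP[t2S t2X] yt2]]] := conn_edge (conn_compl G4 S4) tS tX gS gX.
move: t2S; rewrite SE !inE !negb_or => /and3P[t2u t2v t2w].
move: t2X; rewrite XE negb_or => /andP[t2a t2X].
have Xcase : y \in a \/ y \in off s /\ exists z t1,
      [/\ z \in component (off s) y, t1 \in a & adj z t1].
  move: yX; rewrite XE => /orP[|/andP[yo /exists_inP[z zD /existsP[t1 /andP[t1a zt1]]]]].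
    by left.
  by right; split=> //; exists z, t1.
exists y, t2; split=> //.
apply/negPn/negP => t2b.
have t2o : t2 \in off s.
  by rewrite offE t2w /s !(inE, mem_cat) !negb_or t2u t2a t2v t2b.
move/negP: t2X; apply; rewrite t2o /=.
case: Xcase => [ya|[yo [z [t1 [zD t1a zt1]]]]].
  apply/exists_inP; exists t2; first exact: mem_comp.
  by apply/existsP; exists y; rewrite ya adj_sym.
apply/exists_inP; exists z; last by apply/existsP; exists t1; rewrite t1a.
suff <- : component (off s) y = component (off s) t2 by [].
by apply: comp_eq; rewrite (comp_closed t2 yo t2o yt2) mem_comp.
Qed.

Lemma chord_theta u v a b : good (u :: a ++ v :: b) -> adj u v -> theta u v a b [::].
Proof.
case=> cs us _ _ uv.
move: cs; rewrite /cycle path_mid => /andP[pa pb]; split; rewrite //= ?uv // cats0.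
rewrite -[_ && _]/(uniq (u :: v :: a ++ b)) -(perm_uniq (s1 := u :: a ++ v :: b)) //.
by apply/permP => q; rewrite /= ?count_cat /= ?count_cat /=; clear; lia.
Qed.

(* Otherwise the chord runs on the side of [w] and can be used to reroute. *)
Lemma chord_parity u v a b : optimal (u :: a ++ v :: b) -> adj u v ->
  a != [::] -> b != [::] -> {in a & b, forall t t',
    I t (u :: v :: b) (+) I t' (u :: a ++ [:: v]) = I w (u :: a ++ v :: b)}.
Proof.
move=> opt uv a0 b0 t t' ta tb.
have th := chord_theta (proj1 opt) uv.
apply/eqP/negPn/negP => ne.
apply: (reroute opt th) => //; rewrite ?cats0 // => t1 t1' ta' tb'.
rewrite (theta_const_left th ta' ta) (theta_const_right th tb' tb) /=.
by move: ne; rewrite /=; move: (I _ _) (I _ _) (I _ _); do 3!case.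
Qed.

(** By [bridge_exit], an edge or a component links the two arcs cut off by [uv]. By [chord_parity]
    and [optimal_separates] respectively, it runs, like [uv] itself, on the side away from [w], and
    there the two would cross. *)
Lemma no_chord u v a b : optimal (u :: a ++ v :: b) -> a != [::] -> b != [::] ->
  ~~ adj u v.
Proof.
move=> opt a0 b0; apply/negP => uv; have chord := chord_parity opt uv a0 b0.
have [[cs us _ ws] _] := opt.
have [t ta] : exists t, t \in a by case: (a) a0 => // y p _; exists y; rewrite inE eqxx.
have [g gb] : exists g, g \in b by case: (b) b0 => // y p _; exists y; rewrite inE eqxx.
have Ug := uniq_count_le1 g us.
have gin (q : seq G) : (g \in q) = (0 < count_mem g q) by rewrite -has_count has_pred1.
have ga : g \notin a.
  by move: gb Ug; rewrite !gin /= count_cat /=; clear; lia.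
have gS : g \notin [:: u; v; w].
  rewrite !inE !negb_or; move: (gb) Ug; rewrite gin /= count_cat /= => g0 g1.
  apply/and3P; split.
  - by apply/eqP => e; move: g0 g1; rewrite e eqxx; clear; lia.
  - by apply/eqP => e; move: g0 g1; rewrite e eqxx; clear; lia.
  - by apply: contraNneq ws => <-; rewrite inE mem_cat inE gb !orbT.
have [|y [t2 [t2b yt2 ycase]]] := bridge_exit opt ta gS ga.
  by move=> z y _ _; rewrite offE inE mem_cat inE gb !orbT andbF.
case: ycase => [ya|[yo [z [t1 [zD t1a zt1]]]]].
  have e := chord y t2 ya t2b.
  move: opt us cs e; case/splitPr: ya => a1 a2; case/splitPr: t2b => b1 b2.
  move=> opt us cs e; have E : (a1 ++ y :: a2) ++ v :: b1 ++ t2 :: b2 =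
    a1 ++ y :: a2 ++ v :: b1 ++ t2 :: b2 by rewrite -catA.
  have opt' := optimal_across opt.
  have E' : I w (y :: (a2 ++ v :: b1) ++ t2 :: (b2 ++ u :: a1)) =
      I w (u :: (a1 ++ y :: a2) ++ v :: b1 ++ t2 :: b2).
    rewrite E (cycle_parity_rot m w (u :: a1) (y :: a2 ++ v :: b1 ++ t2 :: b2)).
    by rewrite /= -!catA /= -!catA.
  have vin : v \in a2 ++ v :: b1 by rewrite mem_cat inE eqxx orbT.
  have uin : u \in b2 ++ u :: a1 by rewrite mem_cat inE eqxx orbT.
  have n1 : a2 ++ v :: b1 != [::] by case: (a2).
  have n2 : b2 ++ u :: a1 != [::] by case: (b2).
  have := chord_parity opt' yt2 n1 n2 vin uin; rewrite E'.
  rewrite E in us cs.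
  have := cycle_orderings_parity mC lN mP us cs uv yt2.
  move: e; rewrite -!catA /= => ->.
  by move=> /eqP + e; rewrite e addbb.
have th := chord_theta (proj1 opt) uv; have [_ c13 c23] := theta_cycles th.
have yw : y != w by move: yo; rewrite offE => /andP[].
have ys : y \notin u :: a ++ v :: b by move: yo; rewrite offE => /andP[].
have in13 : {subset u :: a ++ [:: v] <= u :: a ++ v :: b}.
  by move=> r; rewrite !(inE, mem_cat) => /or3P[] ->; rewrite ?orbT.
have in23 : {subset u :: v :: b <= u :: a ++ v :: b}.
  by move=> r; rewrite !(inE, mem_cat) => /or3P[] ->; rewrite ?orbT.
have nsub (q : seq G) r : {subset q <= u :: a ++ v :: b} ->
    r \notin u :: a ++ v :: b -> r \notin q.
  by move=> sub; apply: contra; apply: sub.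
have e13 : I y (u :: a ++ [:: v]) = I t2 (u :: a ++ [:: v]).
  apply: (parity_edge mP c13 yt2); first exact: nsub in13 ys.
  have := uniq_count_le1 t2 us; move: t2b; rewrite -!has_pred1 !has_count /= !count_cat /=.
  by clear; lia.
have offs (q : seq G) : {subset q <= u :: a ++ v :: b} ->
    {in off (u :: a ++ v :: b), forall r, r \notin q}.
  by move=> sub r; rewrite offE => /andP[_]; apply: nsub.
have zo := subsetP (comp_sub yo) _ zD.
have e23 : I y (u :: v :: b) = I t1 (u :: v :: b).
  have yz : connect (rel_in (off (u :: a ++ v :: b))) y z by move: zD; rewrite inE.
  rewrite (parity_connect mP c23 (offs _ in23) yz).
  apply: (parity_edge mP c23 zt1); first exact: offs in23 _ zo.
  have := uniq_count_le1 t1 us; move: t1a; rewrite -!has_pred1 !has_count /= !count_cat /=.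
  by clear; lia.
have := chord t1 t2 t1a t2b; rewrite -e13 -e23 addbC.
have := theta_add mC u v a b [::] y; rewrite (optimal_separates opt ys yw) /= => <-.
by case: (I w _).
Qed.

Lemma no_chord_across u v a b y t : optimal (u :: a ++ v :: b) ->
  y \in a -> t \in b -> ~~ adj y t.
Proof.
move=> opt ya tb; move: opt; case/splitPr: ya => a1 a2; case/splitPr: tb => b1 b2.
by move/optimal_across/no_chord; apply; [case: (a2) | case: (b2)].
Qed.

(** Both components lie on the side away from [w]. A path [c] through the first one gives a theta
    whose relation [theta_key] contradicts [theta_add] for [x'], because [x'] has the parities of
    [t1] and [t2]. *)
Lemma components_cross u v a b x x' z1 z2 y1 y2 t1 t2
    (O := off (u :: a ++ v :: b)) :
  optimal (u :: a ++ v :: b) -> x \in O -> x' \in O -> x' \notin component O x ->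
  z1 \in component O x -> adj z1 u -> z2 \in component O x -> adj z2 v ->
  y1 \in component O x' -> t1 \in a -> adj y1 t1 ->
  y2 \in component O x' -> t2 \in b -> adj y2 t2 -> False.
Proof.
move=> opt xO x'O nx' z1D z1u z2D z2v y1D t1a yt1 y2D t2b yt2.
have [c [th wc z1c cD]] := component_theta (proj1 opt) xO z1D z1u z2D z2v.
have [c12 c13 c23] := theta_cycles th; have [U _ _ _] := th.
have D'O : component O x' \subset O := comp_sub x'O.
have D'c z : z \in component O x' -> z \notin c.
  move=> zD'; apply/negP => /cD zD; move/negP: nx'; apply.
  by rewrite -(comp_eq zD) (comp_eq zD') mem_comp.
have off13 : {in component O x', forall z, z \notin u :: a ++ v :: rev c}.
  move=> z zD'; have := subsetP D'O _ zD'; have := D'c z zD'.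
  rewrite offE !(inE, mem_cat) mem_rev !negb_or => -> /andP[_ /and4P[-> -> -> _]].
  by [].
have off23 : {in component O x', forall z, z \notin u :: c ++ v :: b}.
  move=> z zD'; have := subsetP D'O _ zD'; have := D'c z zD'.
  rewrite offE !(inE, mem_cat) !negb_or => -> /andP[_ /and4P[-> _ -> ->]].
  by [].
have cD' := comp_conn x'O.
have e13 : I x' (u :: a ++ v :: rev c) = I t2 (u :: a ++ v :: rev c).
  rewrite (parity_connect mP c13 off13 (cD' _ _ (mem_comp _ _) y2D)).
  apply: (parity_edge mP c13 yt2); first exact: off13.
  have := uniq_count_le1 t2 U; move: t2b; rewrite -!has_pred1 !has_count /= ?count_cat /= ?count_cat count_rev.
  by clear; lia.
have e23 : I x' (u :: c ++ v :: b) = I t1 (u :: c ++ v :: b).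
  rewrite (parity_connect mP c23 off23 (cD' _ _ (mem_comp _ _) y1D)).
  apply: (parity_edge mP c23 yt1); first exact: off23.
  have := uniq_count_le1 t1 U; move: t1a; rewrite -!has_pred1 !has_count /= ?count_cat /= ?count_cat.
  by clear; lia.
have sep z : z \in O -> I z (u :: a ++ v :: b) = ~~ I w (u :: a ++ v :: b).
  by rewrite offE => /andP[zw zs]; apply: optimal_separates.
have := theta_key mC lN mP th t1a t2b z1c; rewrite -e13 -e23 addbC.
have := theta_add mC u v a b c x'; rewrite sep // (sep z1); last exact: subsetP (comp_sub xO) _ z1D.
by move: (I x' _) (I x' _) (I w _); do 3!case.
Qed.

(** If [t] were not attached, let [u'] and [v'] be the nearest attached vertices on either side of
    it. The arc between them has no attachment, so [bridge_exit] links it to the other arc by a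
    chord, excluded above, or by a component that crosses the one of [x]. *)
Lemma all_attached s x t : optimal s -> x \in off s -> t \in s ->
  exists2 z, z \in component (off s) x & adj z t.
Proof.
move=> opt xo ts; set D := component (off s) x.
pose P r := [exists z in D, adj z r].
have [/exists_inP[z zD zt]|nPt] := boolP (P t); first by exists z.
exfalso.
have [u [v [z1 [z2 [us vs uv [z1D z1u z2D z2v]]]]]] := two_attachments (proj1 opt) xo.
have Pu : P u by apply/exists_inP; exists z1.
have Pv : P v by apply/exists_inP; exists z2.
have [r [opt' eqr]] : exists r, optimal (t :: r) /\ t :: r =i s.
  move: opt {us vs xo D z1D z2D P nPt Pu Pv}; case/splitPr: ts => p q opt.
  exists (q ++ p); split; first exact: (@optimal_rot p (t :: q)).
  by move=> z; rewrite -cat_cons !mem_cat orbC.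
have inr z : z \in s -> P z -> z \in r.
  by rewrite -eqr inE => /orP[/eqP->|//]; rewrite (negPf nPt).
have hasr : has P r by apply/hasP; exists u; rewrite ?inr.
move: (inr u us Pu) (inr v vs Pv) opt' eqr; case: (split_find hasr) => v' r1 r2 Pv' nr1.
move=> ur vr opt' eqr.
have hasr2 : has P r2.
  have out z : P z -> z \in rcons r1 v' ++ r2 -> z != v' -> z \in r2.
    move=> Pz; rewrite mem_cat mem_rcons inE => /orP[/orP[->//|zr1]|//].
    by move/hasPn: nr1 => /(_ _ zr1); rewrite Pz.
  have [uv'|uv'] := eqVneq u v'.
    by apply/hasP; exists v => //; apply: out => //; rewrite -uv' eq_sym.
  by apply/hasP; exists u => //; apply: out.
have hasr2' : has P (rev r2) by rewrite has_rev.
have [u' [q1 [q2 [r2E Pu' nq1]]]] : exists u' q1 q2,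
    [/\ r2 = q2 ++ u' :: q1, P u' & ~~ has P q1].
  rewrite -(revK r2); case: (split_find hasr2') => u' q1 q2 Pu' nq1.
  exists u', (rev q1), (rev q2); rewrite has_rev; split=> //.
  by rewrite rev_cat rev_rcons.
have opt2 : optimal (u' :: (q1 ++ t :: r1) ++ v' :: q2).
  have -> : u' :: (q1 ++ t :: r1) ++ v' :: q2 = (u' :: q1) ++ (t :: r1 ++ v' :: q2).
    by rewrite /= -catA.
  apply: optimal_rot; move: opt'; rewrite r2E /=.
  by rewrite cat_rcons -catA.
set a := q1 ++ t :: r1 in opt2; set b := q2 in opt2.
have eqs : u' :: a ++ v' :: b =i s.
  move=> z; rewrite -eqr r2E /a /b !(inE, mem_cat, mem_rcons).
  by do !case: (_ \in _); do !case: (_ == _).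
have eqo : off s = off (u' :: a ++ v' :: b) by apply/setP => z; rewrite !offE eqs.
have na z : z \in a -> ~~ P z.
  rewrite /a mem_cat inE => /or3P[zq|/eqP->//|zr].
    by move/hasPn: nq1 => /(_ _ zq).
  by move/hasPn: nr1 => /(_ _ zr).
have ta : t \in a by rewrite /a mem_cat inE eqxx orbT.
have xs : x \notin u' :: a ++ v' :: b by move: xo; rewrite eqo offE => /andP[].
have xa : x \notin a.
  by move: xs; rewrite !(inE, mem_cat) !negb_or => /and3P[].
have xS : x \notin [:: u'; v'; w].
  move: xs xo; rewrite offE !(inE, mem_cat) !negb_or => /and4P[-> _ -> _] /andP[-> _].
  by [].
have nDa z y : z \in D -> y \in a -> ~~ adj z y.
  by move=> zD ya; apply: contra (na y ya) => zy; apply/exists_inP; exists z.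
have [|y [t2 [t2b yt2 ycase]]] := bridge_exit opt2 ta xS xa.
  by move=> z y; rewrite -eqo => zD ya _; apply: nDa.
case: ycase => [ya|[yo [z [t1 [zD t1a zt1]]]]].
  by have := no_chord_across opt2 ya t2b; rewrite yt2.
have /exists_inP[z3 z3D z3u] := Pu'; have /exists_inP[z4 z4D z4v] := Pv'.
have xo' : x \in off (u' :: a ++ v' :: b) by rewrite -eqo.
apply: (components_cross opt2 xo' yo _ (z1 := z3) (z2 := z4) _ z3u _ z4v zD t1a zt1 (mem_comp _ _) t2b yt2).
- apply/negP; rewrite -eqo -/D => yD.
  have : z \in D by rewrite /D -(comp_eq yD) eqo.
  by move=> zD'; have := nDa z t1 zD' t1a; rewrite zt1.
- by rewrite -eqo.
- by rewrite -eqo.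
Qed.

Lemma neighbours_on_cycle s z : optimal s -> adj w z -> z \in s.
Proof.
move=> opt wz; apply/negPn/negP => zs.
have zw : z != w by apply: contraTneq wz => ->; rewrite adj_irrefl.
have [[cs _ _ ws] _] := opt.
have := optimal_separates opt zs zw.
by rewrite (parity_edge mP cs wz ws zs); case: (I z s).
Qed.

(** Delete [w] and the two neighbours [x], [y] of [t] on the cycle. A vertex [t] of the cycle still
    has a neighbour, and this is off the cycle for lack of chords. *)
Lemma off_nonempty s : optimal s -> exists x, x \in off s.
Proof.
move=> opt; have [[_ us s2 ws] _] := opt.
case: s opt us s2 ws => [|t [|x r]] // opt us s2 ws.
case/lastP: r opt us s2 ws => // r y opt us s2 ws.
have [g] : exists g, g \notin t |: (x |: (y |: [set w])).
  by apply: vertex_outside => //; rewrite !cardsU1 cards1; do 3!case: (_ \notin _).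
rewrite !inE !negb_or => /and4P[gt gx gy gw].
have S4 : #|x |: (y |: [set w])| < 4.
  by rewrite !cardsU1 cards1; do 2!case: (_ \notin _).
have tS : t \in ~: (x |: (y |: [set w])).
  move: us ws; rewrite /= !inE !mem_rcons !inE !negb_or.
  by move=> /andP[/and3P[-> -> _] _] /andP[wt _]; rewrite eq_sym.
have gS : g \in ~: (x |: (y |: [set w])) by rewrite !inE !negb_or gx gy gw.
have gt' : g \notin [set t] by rewrite inE.
have [t' [z [/setIP[_ /set1P->] /setDP[zS zt] tz]]] :=
  conn_edge (conn_compl G4 S4) tS (set11 t) gS gt'.
move: zS zt; rewrite !inE !negb_or => /and3P[zx zy zw] zt.
exists z; rewrite offE zw /=; apply/negP => zs.
have zr : z \in r.
  by move: zs; rewrite !(inE, mem_rcons) (negPf zt) (negPf zx) (negPf zy).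
move: opt; rewrite -cats1; case/splitPr: zr => r1 r2; rewrite -catA /= => opt.
have := @no_chord t z (x :: r1) (r2 ++ [:: y]) opt.
by rewrite tz; case: (r2) => [|? ?] /(_ isT isT).
Qed.

(** Two components would both be attached to four consecutive vertices [u], [t1], [v], [t2] of the
    cycle and hence cross. The cycle has four vertices because it contains all neighbours of [w]. *)
Lemma off_connected s : optimal s -> conn (off s).
Proof.
move=> opt x x' xo x'o; have [|nx'] := boolP (x' \in component (off s) x).
  by rewrite inE.
have [[_ us _ ws] _] := opt.
have s4 : 3 < size s.
  apply: leq_trans (degree_geq4 G4 w) _; apply: leq_trans (card_size s).
  by apply/subset_leq_card/subsetP => z; rewrite inE; apply: neighbours_on_cycle.
case: s opt xo x'o nx' us ws s4 => [|u [|t1 [|v [|t2 r]]]] // opt xo x'o nx' _ _ _.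
have att y t (yo : y \in off [:: u, t1, v, t2 & r]) ht := all_attached (t := t) opt yo ht.
have [|z1 z1D z1u] := att x u xo; first by rewrite inE eqxx.
have [|z2 z2D z2v] := att x v xo; first by rewrite !inE eqxx ?orbT.
have [|y1 y1D y1t] := att x' t1 x'o; first by rewrite !inE eqxx ?orbT.
have [|y2 y2D y2t] := att x' t2 x'o; first by rewrite !inE eqxx ?orbT.
exfalso; apply: (@components_cross u v [:: t1] (t2 :: r) x x' z1 z2 y1 y2 t1 t2) => //;
  by rewrite inE eqxx.
Qed.
End Link.

(** * Cutting a cycle into arcs *)

Section CycleBlocks.
Variables (T : eqType) (e : rel T).
Implicit Types (x y : T) (p q r s : seq T).

Lemma cycle_rotate p q : cycle e (p ++ q) = cycle e (q ++ p).
Proof. by rewrite -(rot_size_cat p q) rot_cycle. Qed.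

Lemma cycle_block_path p y q r : cycle e (p ++ (y :: q) ++ r) -> path e y q.
Proof.
rewrite cycle_rotate -catA /= -cats1 -!catA cat_path => /andP[]//.
Qed.

Lemma cycle_blocks_adjacent p q1 q2 r : cycle e (p ++ q1 ++ q2 ++ r) ->
  q1 != [::] -> q2 != [::] -> exists x y, [/\ x \in q1, y \in q2 & e x y].
Proof.
case/lastP: q1 => // q1 x; case: q2 => // y q2 + _ _.
rewrite cat_rcons catA cycle_rotate /= => /andP[xy _].
by exists x, y; rewrite mem_rcons !inE !eqxx.
Qed.

Lemma split_count (P : pred T) k s : k < count P s ->
  exists s1 s2, [/\ s = s1 ++ s2, has P s1 & k <= count P s2].
Proof.
move=> lt; have hs : has P s by rewrite has_count; apply: leq_ltn_trans lt.
case: (split_find hs) lt => x s1 s2 Px ns1.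
rewrite count_cat -cats1 count_cat /= Px.
move: ns1; rewrite has_count -eqn0Ngt => /eqP-> /= lt.
by exists (s1 ++ [:: x]), s2; rewrite has_cat /= Px orbT.
Qed.
End CycleBlocks.

Section OctExistence.
Variable G : sgraph.
Hypothesis G4 : k_connected 4 G.

(** A vertex [x] other than [w] has two neighbours different from [w]; join them by a path that
    avoids [w] and [x], and close it through [x]. *)
Lemma good_exists (w : G) : exists s, good w s.
Proof.
have [x xw] : exists x, x \notin [set w] by apply: vertex_outside; rewrite ?cards1.
have : 1 < #|[set z | adj x z] :\ w|.
  have := degree_geq4 G4 x; rewrite (cardsD1 w); case: (_ \in _) => /=; clear; lia.
case/card_gt1P => y [y' [yN y'N yy']].
move: yN y'N; rewrite !inE => /andP[yw xy] /andP[y'w xy'].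
have S4 : #|[set w; x]| < 4 by rewrite cards2; case: (_ != _).
have out z : z != w -> adj x z -> z \in ~: [set w; x].
  by move=> zw xz; rewrite !inE negb_or zw /=; apply: contraTneq xz => ->; rewrite adj_irrefl.
have yO := out y yw xy; have y'O := out y' y'w xy'.
have [p [pp lp up sp]] := connect_path yO (conn_compl G4 S4 yO y'O).
exists (x :: y :: p); split.
- by rewrite /= xy rcons_path pp lp adj_sym.
- rewrite cons_uniq up andbT; apply/negP => /sp.
  by rewrite !inE eqxx orbT.
- by case: p lp yy' {pp up sp} => //= ->; rewrite eqxx.
- rewrite inE negb_or eq_sym; move: xw; rewrite inE => ->.
  by apply/negP => /sp; rewrite !inE eqxx.
Qed.

(** The antipodal pairs are [w] and the vertices off the cycle, [s1] and [s3], [s2] and [s4]. The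
    first coordinate thus separates consecutive arcs, and the second is [None] for the two hubs. *)
Definition hub_rim (w : G) (s1 s2 s3 s4 : seq G) (x : G) : bool * option bool :=
  if x == w then (false, None)
  else if x \in s1 then (false, Some false)
  else if x \in s2 then (true, Some false)
  else if x \in s3 then (false, Some true)
  else if x \in s4 then (true, Some true)
  else (true, None).

Lemma oct_model_of_rim (w : G) (s1 s2 s3 s4 : seq G) (s := s1 ++ s2 ++ s3 ++ s4)
    (K := ~: ([set w] :|: [set z in s])) :
  cycle (@adj _) s -> uniq s -> w \notin s ->
  has (adj w) s1 -> has (adj w) s2 -> has (adj w) s3 -> has (adj w) s4 ->
  (exists x, x \in K) -> conn K -> (forall x, x \in s -> exists2 z, z \in K & adj z x) ->
  exists f : G -> Oct, model (@adj Oct) f.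
Proof.
move=> cs us ws h1 h2 h3 h4 [k kK] cK att.
pose g := hub_rim w s1 s2 s3 s4.
have Us z := uniq_count_le1 z us.
have cin z (q : seq G) : (z \in q) = (0 < count_mem z q) by rewrite -has_count has_pred1.
have sub1 z : z \in s1 -> z \in s by rewrite mem_cat => ->.
have sub2 z : z \in s2 -> z \in s by rewrite !mem_cat => ->; rewrite !orbT.
have sub3 z : z \in s3 -> z \in s by rewrite !mem_cat => ->; rewrite !orbT.
have sub4 z : z \in s4 -> z \in s by rewrite !mem_cat => ->; rewrite !orbT.
have nw z : z \in s -> (z == w) = false.
  by move=> zs; apply/negbTE; apply: contraNneq ws => <-.
have KE z : (z \in K) = (z != w) && (z \notin s) by rewrite !inE negb_or.
have g0 : g w = (false, None) by rewrite /g /hub_rim eqxx.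
have g1 z : z \in s1 -> g z = (false, Some false).
  by move=> z1; rewrite /g /hub_rim nw ?sub1 // z1.
have g2 z : z \in s2 -> g z = (true, Some false).
  move=> z2; rewrite /g /hub_rim nw ?sub2 // z2.
  have -> : z \in s1 = false by move: (Us z) z2; rewrite !cin /s !count_cat; clear; lia.
  by [].
have g3 z : z \in s3 -> g z = (false, Some true).
  move=> z3; rewrite /g /hub_rim nw ?sub3 // z3.
  have -> : z \in s1 = false by move: (Us z) z3; rewrite !cin /s !count_cat; clear; lia.
  have -> : z \in s2 = false by move: (Us z) z3; rewrite !cin /s !count_cat; clear; lia.
  by [].
have g4 z : z \in s4 -> g z = (true, Some true).
  move=> z4; rewrite /g /hub_rim nw ?sub4 // z4.
  have -> : z \in s1 = false by move: (Us z) z4; rewrite !cin /s !count_cat; clear; lia.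
  have -> : z \in s2 = false by move: (Us z) z4; rewrite !cin /s !count_cat; clear; lia.
  have -> : z \in s3 = false by move: (Us z) z4; rewrite !cin /s !count_cat; clear; lia.
  by [].
have gK z : z \in K -> g z = (true, None).
  rewrite KE /s !mem_cat !negb_or => /andP[zw /and4P[z1 z2 z3 z4]].
  by rewrite /g /hub_rim (negPf zw) (negPf z1) (negPf z2) (negPf z3) (negPf z4).
pose fib (h : bool * option bool) : {set G} :=
  match h with
  | (false, None) => [set w]
  | (true, None) => K
  | (false, Some false) => [set z in s1]
  | (true, Some false) => [set z in s2]
  | (false, Some true) => [set z in s3]
  | (true, Some true) => [set z in s4]
  end.
have fibP h z : z \in fib h -> g z = h.
  case: h => -[] [[]|] /=.
  - by rewrite in_set; apply: g4.
  - by rewrite in_set; apply: g2.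
  - exact: gK.
  - by rewrite in_set; apply: g3.
  - by rewrite in_set; apply: g1.
  - by rewrite in_set1 => /eqP->.
have fib_total z : exists h, z \in fib h.
  have [->|zw] := eqVneq z w; first by exists (false, None); rewrite /= inE.
  have [zs|zs] := boolP (z \in s); last by exists (true, None); rewrite /= KE zw.
  move: zs; rewrite /s !mem_cat => /or4P[] zs.
  - by exists (false, Some false); rewrite /= inE.
  - by exists (true, Some false); rewrite /= inE.
  - by exists (false, Some true); rewrite /= inE.
  - by exists (true, Some true); rewrite /= inE.
have fibE h : [set x | g x == h] = fib h.
  apply/setP => z; rewrite in_set; apply/eqP/idP; last exact: fibP.
  by move=> gz; have [h' zh'] := fib_total z; rewrite -gz (fibP _ _ zh').
have block p q r : s = p ++ q ++ r -> has (adj w) q -> conn [set z in q].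
  move=> E; case: q E => // y q E _; apply: path_conn.
  by apply: (@cycle_block_path _ (@adj G) p y q r); rewrite -E.
have nonempty (q : seq G) : has (adj w) q -> q != [::] by case: q.
have block_touch p q1 q2 r : cycle (@adj _) (p ++ q1 ++ q2 ++ r) ->
    has (adj w) q1 -> has (adj w) q2 -> forall h1 h2 : bool * option bool,
    fib h1 = [set z in q1] -> fib h2 = [set z in q2] -> touch g h1 h2.
  move=> cq n1 n2 l1 l2 e1 e2.
  have [x [y [xq yq xy]]] := cycle_blocks_adjacent cq (nonempty _ n1) (nonempty _ n2).
  by apply/touchP; exists x, y; split=> //; apply: fibP; rewrite ?e1 ?e2 inE.
have hub_touch q h : has (adj w) q -> {subset q <= s} -> fib h = [set z in q] ->
    touch g (false, None) h /\ touch g (true, None) h.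
  move=> /hasP[z zq wz] qs eh.
  have gz : g z = h by apply: fibP; rewrite eh inE.
  split; apply/touchP; first by exists w, z.
  by have [y yK yz] := att z (qs z zq); exists y, z; rewrite (gK y yK).
pose i0 : 'I_3 := inord 0; pose i1 : 'I_3 := inord 1; pose i2 : 'I_3 := inord 2.
have i10 : i1 != i0 by rewrite -val_eqE /= !inordK.
have i20 : i2 != i0 by rewrite -val_eqE /= !inordK.
have i21 : i2 != i1 by rewrite -val_eqE /= !inordK.
pose phi (h : bool * option bool) : Oct :=
  if h.2 is Some c then (if h.1 then i2 else i1, c) else (i0, h.1).
pose psi (o : Oct) : bool * option bool :=
  if o.1 == i0 then (o.2, None) else (o.1 == i2, Some o.2).
have psiK : cancel psi phi.
  case=> a b; rewrite /phi /psi /=; case: (ord3P a) => -> /=.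
  - by rewrite eqxx.
  - by rewrite (negPf i10) /= eq_sym (negPf i21).
  - by rewrite (negPf i20) /= eqxx.
have phiK : cancel phi psi.
  case=> a [b|]; rewrite /phi /psi /=; last by rewrite eqxx.
  case: a => /=; first by rewrite (negPf i20) eqxx.
  by rewrite (negPf i10) eq_sym (negPf i21).
exists (fun x => phi (g x)); apply: (coarsen_model (psi := psi)) => //.
- move=> h; suff [x /fibP gx] : exists x, x \in fib h by exists x.
  have ne (q : seq G) : has (adj w) q -> exists x, x \in [set z in q].
    by case/hasP=> x xq _; exists x; rewrite inE.
  case: h => -[] [[]|] /=; try exact: ne; first by exists k.
  by exists w; rewrite inE.
- apply/fiber_connP => h; rewrite fibE; case: h => -[] [[]|] /=.
  + by apply: (block (s1 ++ s2 ++ s3) s4 [::]); rewrite // cats0 -!catA.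
  + by apply: (block s1 s2 (s3 ++ s4)).
  + exact: cK.
  + by apply: (block (s1 ++ s2) s3 s4); rewrite // -!catA.
  + by apply: (block [::] s1 (s2 ++ s3 ++ s4)).
  + exact: conn1.
- by move=> h1' h2' /(can_inj phiK); left.
have rim c c' : touch g (false, Some c) (true, Some c').
  case: c c' => -[].
  + by apply: (block_touch (s1 ++ s2) s3 s4 [::]); rewrite // cats0 -!catA.
  + by rewrite touch_sym; apply: (block_touch s1 s2 s3 s4).
  + rewrite touch_sym; apply: (block_touch [::] s4 s1 (s2 ++ s3)) => //.
    by rewrite /= (cycle_rotate _ s4 (s1 ++ s2 ++ s3)) -!catA.
  + by apply: (block_touch [::] s1 s2 (s3 ++ s4)).
have hub b i c : touch g (b, None) (i, Some c).
  have [H1 H1'] := hub_touch s1 (false, Some false) h1 sub1 erefl.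
  have [H2 H2'] := hub_touch s2 (true, Some false) h2 sub2 erefl.
  have [H3 H3'] := hub_touch s3 (false, Some true) h3 sub3 erefl.
  have [H4 H4'] := hub_touch s4 (true, Some true) h4 sub4 erefl.
  by case: b i c => [] [] [].
move=> [a b] [a' b'] aa'; have {}aa' : a != a' := aa'.
rewrite /psi /=; have [a0|a0] := eqVneq a i0; have [a'0|a'0] := eqVneq a' i0.
- by rewrite a0 a'0 eqxx in aa'.
- exact: hub.
- by rewrite touch_sym; exact: hub.
have [a2|a2] := eqVneq a i2; have [a'2|a'2] := eqVneq a' i2.
- by rewrite a2 a'2 eqxx in aa'.
- by rewrite touch_sym; exact: rim.
- exact: rim.
have one t : t != i0 -> t != i2 -> t = i1.
  by case: (ord3P t) => ->; rewrite ?eqxx.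
by rewrite (one a) // (one a') // eqxx in aa'.
Qed.
End OctExistence.

Theorem planar_oct_model (R : realType) (G : sgraph) :
  k_connected 4 G -> planar R G ->
  (exists f : G -> Oct, model (@adj Oct) f) /\
  forall h : G -> bool * 'I_3, ~ model [rel x y : bool * 'I_3 | x.1 != y.1] h.
Proof.
move=> G4 /planar_parity[m [l [mC lN mP]]].
split; last by move=> h; apply: (no_K33_model lN mP).
have /card_gt0P[w _] : 0 < #|G| by apply: leq_ltn_trans G4.1.
have [s0 gs0] := good_exists G4 w.
have [s gs min] := exists_minimal (weight m w) gs0.
have opt : optimal m w s by split.
have [cs us s2 ws] := gs.
have : 3 < count (adj w) s.
  apply: leq_trans (degree_geq4 G4 w) _.
  rewrite -size_filter; apply: leq_trans (card_size _).
  apply/subset_leq_card/subsetP => z; rewrite inE mem_filter => wz; rewrite wz /=.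
  exact: (neighbours_on_cycle G4 mC lN mP opt wz).
(* Each cut spends just one of the four neighbours of [w], so the last arc keeps at least one. *)
case/split_count => s1 [r [E h1]] /split_count[s2' [r' [E' h2]]].
case/split_count => s3 [s4 [E'' h3 h4]].
rewrite E E' E'' in cs us ws opt.
apply: (@oct_model_of_rim G w s1 s2' s3 s4) => //.
- by rewrite has_count.
- exact: (off_nonempty G4 mC lN mP opt).
- exact: (off_connected G4 mC lN mP opt).
- have [x xo] := off_nonempty G4 mC lN mP opt.
  move=> t ts; have [z zD zt] := all_attached G4 mC lN mP opt xo ts.
  by exists z => //; apply: subsetP zD; apply: comp_sub.
Qed.

Theorem theorem3p2 (R : realType) (G : sgraph) :
  k_connected 4 G -> planar R G ->
  (minor_free Oct1p G <-> isomorphic G C62).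
Proof.
move=> G4 planG; have [[f fM] noK33] := planar_oct_model G4 planG.
(* The implication from the isomorphism is the count of seven vertices against six. *)
split=> [free|[g [/bij_eq_card cardG _]] /minor_card]; last first.
  rewrite cardG card_ord card_sum card_bool card_sig.
  by rewrite (eq_card (B := predC1 oct_v)) // cardC1 card_prod card_ord card_bool.
apply: isomorphic_trans oct_C62.
apply: isomorphic_oct fM => //; first exact: no_K33_model_of.
by move=> h /model_minor.
Qed.
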